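(* Assume (A) and $\mathbf p=\mathbf u$. Then $$n\begin{pmatrix}H(\hat{\mathbf p})-\log m!\\ D(\hat{\mathbf p})\end{pmatrix}\xrightarrow{d}\begin{pmatrix}-\frac{m!}{2}\\[2pt] \frac{m!}{8}\end{pmatrix}Q_m.$$
   Context: Setting: $m\ge2$; $(\Pi_t)$ is the stationary series of ordinal patterns of length $m$ of an underlying process, with values in the $m!$ OPs $\pi_1,\dots,\pi_{m!}$; $\mathbf p=(p_1,\dots,p_{m!})$, $p_i=\mathbb P(\Pi_0=\pi_i)$; $\hat{\mathbf p}$ is the vector of relative frequencies $\hat p_i=\frac1n\sum_{t=1}^n\mathbb 1\{\Pi_t=\pi_i\}$; $p_{ij}(k)=\mathbb P(\Pi_0=\pi_i,\Pi_k=\pi_j)$; $\Sigma=(\sigma_{ij})$ with $\sigma_{ij}=p_i(\delta_{ij}-p_j)+\sum_{k=1}^\infty(p_{ij}(k)+p_{ji}(k)-2p_ip_j)$ (absolutely convergent). Standing assumption (A): $\sqrt n(\hat{\mathbf p}-\mathbf p)\xrightarrow{d}N(\mathbf 0,\Sigma)$. $\mathbf u=(1/m!,\dots,1/m!)$. Shannon entropy $H(\mathbf p)=-\sum_k p_k\log p_k$ with $0\log0:=0$; disequilibrium $D(\mathbf p)=H((\mathbf p+\mathbf u)/2)-\frac12H(\mathbf p)-\frac12\log m!$. $Q_m=\sum_{i=1}^l\lambda_i\chi^2_{r_i}$, where $\lambda_1,\dots,\lambda_l$ are the distinct nonzero eigenvalues of $\Sigma$ with algebraic multiplicities $r_1,\dots,r_l$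 and $\chi^2_{r_1},\dots,\chi^2_{r_l}$ are independent chi-square random variables with $r_i$ degrees of freedom. *)

(* Defs.v *)
From HB Require Import structures.
From mathcomp Require Import all_boot all_order all_algebra all_fingroup.
From mathcomp Require Import all_classical all_reals all_analysis.
Set Implicit Arguments. Unset Strict Implicit. Unset Printing Implicit Defensive.
Import Order.TTheory GRing.Theory Num.Theory.
Import numFieldNormedType.Exports.
Local Open Scope classical_set_scope.
Local Open Scope ring_scope.

Section Defs.
Variable R : realType.

Definition prb d (T : measurableType d) (P : probability T R) (A : set T) : R :=
  fine (P A).

Definition Eint d (T : measurableType d) (P : probability T R) (f : T -> R) : \bar R :=
  integral P setT (fun w => (f w)%:E).

Definition ordpat (m : nat) (x : 'I_m -> R) : {perm 'I_m} :=
  odflt 1%g [pick s : {perm 'I_m} | [forall i : 'I_m, forall j : 'I_m,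
     (i < j)%N ==> ((x (s i) < x (s j)) || ((x (s i) == x (s j)) && (s i < s j)%N))]].

Definition OPseries d (T : measurableType d) (m : nat) (X : nat -> T -> R)
  (t : nat) (w : T) : {perm 'I_m} := ordpat (fun i : 'I_m => X (t + i)%N w).

Definition nOP (m : nat) := #|{perm 'I_m}|.
Definition piOP (m : nat) (i : 'I_(nOP m)) : {perm 'I_m} := enum_val i.

Definition stationary d (T : measurableType d) (P : probability T R) (V : finType)
  (Pi : nat -> T -> V) : Prop :=
  forall (k t : nat) (a : 'I_k.+1 -> V),
    P [set w | forall j : 'I_k.+1, Pi (t + j)%N w = a j] =
    P [set w | forall j : 'I_k.+1, Pi j w = a j].

Definition pOP d (T : measurableType d) (P : probability T R) (m : nat)
  (Pi : nat -> T -> {perm 'I_m}) (i : 'I_(nOP m)) : R :=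
  prb P [set w | Pi 0%N w = piOP i].
Definition pOP2 d (T : measurableType d) (P : probability T R) (m : nat)
  (Pi : nat -> T -> {perm 'I_m}) (i j : 'I_(nOP m)) (k : nat) : R :=
  prb P [set w | Pi 0%N w = piOP i /\ Pi k w = piOP j].

Definition sigma_term d (T : measurableType d) (P : probability T R) (m : nat)
  (Pi : nat -> T -> {perm 'I_m}) (i j : 'I_(nOP m)) (k : nat) : R :=
  pOP2 P Pi i j k + pOP2 P Pi j i k - 2 * pOP P Pi i * pOP P Pi j.

Definition SigmaOP d (T : measurableType d) (P : probability T R) (m : nat)
  (Pi : nat -> T -> {perm 'I_m}) : 'M[R]_(nOP m) :=
  \matrix_(i, j) (pOP P Pi i * ((i == j)%:R - pOP P Pi j)
     + limn (fun n => \sum_(1 <= k < n) sigma_term P Pi i j k)).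

Definition phat d (T : measurableType d) (m : nat) (Pi : nat -> T -> {perm 'I_m})
  (n : nat) (w : T) (i : 'I_(nOP m)) : R :=
  n%:R^-1 * (\sum_(1 <= t < n.+1) (Pi t w == piOP i)%:R).

Definition shannonH (N : nat) (p : 'I_N -> R) : R :=
  - \sum_(k < N) (if p k == 0 then 0 else p k * ln (p k)).
Definition diseq (m : nat) (p : 'I_(nOP m) -> R) : R :=
  shannonH (fun k => (p k + (m`!%:R)^-1) / 2) - shannonH p / 2 - ln (m`!%:R) / 2.

Definition cvg_distr (k : nat) d (T : measurableType d) (P : probability T R)
  (Y : nat -> T -> 'rV[R]_k) d' (T' : measurableType d') (Q : probability T' R)
  (Z : T' -> 'rV[R]_k) : Prop :=
  forall f : 'rV[R]_k -> R, continuous f -> (exists M : R, forall x, `|f x| <= M) ->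
    (fun n => Eint P (fun w => f (Y n w))) @ \oo --> Eint Q (fun w => f (Z w)).

(* Z ~ N(0, S): characteristic function t |-> exp(-t S t^T / 2),
   written via its real and imaginary parts *)
Definition is_gaussian (k : nat) d (T : measurableType d) (P : probability T R)
  (Z : T -> 'rV[R]_k) (S : 'M[R]_k) : Prop :=
  forall t : 'rV[R]_k,
    Eint P (fun w => cos (\sum_(i < k) t 0 i * Z w 0 i)) =
      (expR (- (t *m S *m t^T) 0 0 / 2))%:E /\
    Eint P (fun w => sin (\sum_(i < k) t 0 i * Z w 0 i)) = 0%E.

Definition independent_rvs (l : nat) d (T : measurableType d) (P : probability T R)
  (C : 'I_l -> T -> R) : Prop :=
  forall B : 'I_l -> set R, (forall i, measurable (B i)) ->
    P (\bigcap_(i in [set: 'I_l]) (C i @^-1` B i)) = (\prod_(i < l) P (C i @^-1` B i))%E.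

(* C ~ chi^2_r: law with density proportional to x^(r/2-1) e^(-x/2) on (0,oo) *)
Definition chi2_dens (r : nat) (x : R) : R := powR x (r%:R / 2 - 1) * expR (- x / 2).
Definition is_chi2 (r : nat) d (T : measurableType d) (P : probability T R)
  (C : T -> R) : Prop :=
  forall x : R, prb P [set w | C w <= x] =
    fine (integral lebesgue_measure `]0, x]%classic (fun y => (chi2_dens r y)%:E)) /
    fine (integral lebesgue_measure `]0, +oo[%classic (fun y => (chi2_dens r y)%:E)).

Definition nonzero_eigen_spec (N : nat) (S : 'M[R]_N) (l : nat) (lam : 'I_l -> R)
  (r : 'I_l -> nat) : Prop :=
  injective lam /\ (forall i, lam i != 0) /\
  (forall a : R, a != 0 -> (eigenvalue S a <-> exists i, lam i = a)) /\
  (forall i, r i = mup (lam i) (char_poly S)).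

End Defs.
Arguments phat {R d T m} Pi n w i.
Arguments diseq {R m} p.

(* Main.v *)
Require Import Defs.
From HB Require Import structures.
From mathcomp Require Import all_boot all_order all_algebra all_fingroup.
From mathcomp Require Import all_classical all_reals all_analysis.
From mathcomp Require Import measurable_realfun complex ring lra.
Import Order.TTheory GRing.Theory Num.Theory.
Import numFieldNormedType.Exports.
Local Open Scope classical_set_scope.
Local Open Scope ring_scope.

(* Write h = phat - u.  Expanding x ln x to second order at the uniform vector gives
   H(phat) - ln m! = - (m!/2) |h|^2 + O(|h|^3) and D(phat) = (m!/8) |h|^2 + O(|h|^3), so that
   n (H(phat) - ln m!, D(phat)) is uniformly close to (- m!/2, m!/8) V_n on each set
   {V_n <= M}, where V_n = n |h|^2.  By (A) and the continuous mapping theorem V_n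
   converges in law to |Z|^2 with Z ~ N(0, Sigma).  Diagonalizing Sigma, both |Z|^2 and
   sum_i lambda_i chi^2_{r_i} have the Laplace transform
   s |-> prod_i (1 + 2 s lambda_i)^(- r_i / 2), and by Weierstrass approximation in
   the variable exp (- s x) a law on [0, oo) is determined by its Laplace transform. *)

(** Assumption (A) describes [Z] only through its characteristic function, and the chi-square
    variables live on another probability space. The limits are therefore compared as laws of
    nonnegative variables: averaging the characteristic function over Gaussian frequencies yields
    the Laplace transform of |Z|^2 directly, with no density of [Z]. That Sigma has no negative
    eigenvalue is likewise read off the characteristic function, since the expectation of a cosine
    is at most 1. The constant m!/8 arises because (p + u)/2 deviates from u by h/2: the mixture
    contributes -(m!/8)|h|^2, and subtracting half of -(m!/2)|h|^2 gives -m!/8 + m!/4. After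
    multiplication by n the remainder is small only where V_n is bounded: there |h| is of order
    n^(-1/2), and n|h|^3 = |h| V_n. Elsewhere tightness is needed; it comes from the Laplace
    transform of V_n, whose limit is near 1 for small s. The conclusion asserts that the chi-square
    variables exist, so their laws and an independent family are constructed; the total mass of the
    density is never computed, only shown positive and finite. *)

(** * Orthogonal diagonalization of real symmetric matrices *)

(** The reflection along [v - e] exchanges the unit vectors [e] and [v], so its matrix has [v] as
    row 0. If [v = e] there is nothing to reflect and the identity serves. *)
Lemma householder_row (R : rcfType) n (v : 'rV[R]_n.+1) :
  v *m v^T = 1%:M ->
  exists2 H : 'M[R]_n.+1, H *m H^T = 1%:M & row 0 H = v.
Proof.
move=> vv; set e : 'rV[R]_n.+1 := delta_mx 0 0.
have rowE (H : 'M[R]_n.+1) : row 0 H = e *m H by rewrite rowE.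
have ee : e *m e^T = 1%:M.
  by rewrite trmx_delta mul_delta_mx; apply/matrixP => i j; rewrite !ord1 !mxE.
have [v_e|v_ne] := eqVneq v e.
  by exists 1%:M; rewrite ?trmx1 ?mulmx1 // rowE mulmx1 v_e.
(* [c] is the squared norm of [w], because [v] and [e] are unit vectors. *)
pose w := v - e; pose a := (v *m e^T) 0 0; pose c := 2 - 2 * a.
have scal (A : 'M[R]_1) : A = (A 0 0)%:M by exact: mx11_scalar.
have vea : v *m e^T = a%:M by exact: scal.
have eva : e *m v^T = a%:M by rewrite -[LHS]trmxK trmx_mul trmxK vea tr_scalar_mx.
have wT : w^T = v^T - e^T by rewrite /w linearB.
have ww : w *m w^T = c%:M.
  rewrite wT mulmxBl !mulmxBr vv ee eva vea -!scalar_mx_is_additive.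
  by congr (_%:M); rewrite /c; ring.
have c_neq0 : c != 0.
  apply: contra v_ne => /eqP c0; rewrite -subr_eq0; apply/eqP/rowP => i.
  have /matrixP /(_ 0 0) := ww; rewrite c0 !mxE mul0rn => /eqP.
  rewrite psumr_eq0 => [|j _]; last by rewrite [w^T _ _]mxE -expr2 sqr_ge0.
  move=> /allP /(_ i (mem_index_enum _)) /=; rewrite [w^T _ _]mxE -expr2 sqrf_eq0.
  by move=> /eqP; rewrite !mxE.
pose H : 'M[R]_n.+1 := 1%:M - (2 / c) *: (w^T *m w).
have HT : H^T = H by rewrite /H linearB linearZ /= trmx1 trmx_mul trmxK.
exists H.
  have kk : (2 / c) *: (w^T *m w) *m ((2 / c) *: (w^T *m w))
            = (2 / c * 2) *: (w^T *m w).
    rewrite -scalemxAl -scalemxAr mulmxA -(mulmxA _ w) ww mul_mx_scalar.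
    by rewrite -scalemxAl !scalerA; congr (_ *: _); field.
  rewrite HT /H; move: (w^T *m w) kk => K kk.
  rewrite mulmxBl !mulmxBr kk !mul1mx mulmx1.
  rewrite -scalerBl -addrA -opprD -scalerDl.
  by rewrite (_ : 2 / c + _ = 0) ?scale0r ?subr0 //; ring.
have ew : e *m w^T = (a - 1)%:M.
  by rewrite wT mulmxBr ee eva -scalar_mx_is_additive.
have -> : v = e + w by rewrite /w addrC subrK.
rewrite rowE /H; clearbody w.
rewrite mulmxBr mulmx1 -scalemxAr mulmxA ew mul_scalar_mx scalerA.
have -> : 2 / c * (a - 1) = -1 :> R by move: c_neq0; rewrite /c => h; field.
by rewrite scaleN1r opprK.
Qed.

(** Over the complex numbers the matrix is Hermitian, so the spectral theorem gives a real
    eigenvalue; being a root of the characteristic polynomial descends along the embedding of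
    [R]. *)
Lemma symmetric_real_eigenvalue (R : rcfType) n (S : 'M[R]_n.+1) :
  S^T = S -> exists a, eigenvalue S a.
Proof.
move=> Ssym; pose f := real_complex R.
have SCh : map_mx f S \is hermsymmx.
  apply: realsym_hermsym.
    by apply/is_hermitianmxP; rewrite expr0 scale1r map_mx_id // map_trmx Ssym.
  by apply/mxOverP => i j; rewrite mxE complex_real.
have /orthomx_spectralP eqS := hermitian_normalmx SCh.
have /mxOverP /(_ 0 0) /complex_realP [a aE] := hermitian_spectral_diag_real SCh.
exists a; rewrite eigenvalue_root_char -(fmorph_root f) map_char_poly.
rewrite -eigenvalue_root_char; apply/eigenvalueP.
set U := spectralmx _ in eqS; have Uu : U \in unitmx := spectral_unit _.
exists (row 0 U).
  rewrite rowE eqS -!mulmxA mulKVmx //.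
  by rewrite mulmxA -[_ *m diag_mx _]rowE row_diag_mx aE -scalemxAl -rowE.
apply/eqP => U0; have : row 0 U *m invmx U = delta_mx 0 0 by rewrite rowE mulmxK.
by rewrite U0 mul0mx => /rowP /(_ 0) /eqP; rewrite !mxE !eqxx eq_sym oner_eq0.
Qed.

(** Deflation: the complex spectral theorem supplies only a real eigenvalue, its diagonalizing
    matrix being unitary; the orthogonal matrix is rebuilt over [R] by induction on the size. *)
Lemma real_spectral (R : rcfType) n (S : 'M[R]_n) :
  S^T = S -> exists (O : 'M[R]_n) (mu : 'rV[R]_n),
    O *m O^T = 1%:M /\ S = O^T *m diag_mx mu *m O.
Proof.
elim: n S => [|n IH] S Ssym.
  by exists 1%:M, 0; split; apply/matrixP => [[]].
have [a /eigenvalueP [v vS v0]] := symmetric_real_eigenvalue _ _ _ Ssym.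
pose c := \sum_i v 0 i ^+ 2.
have c_gt0 : 0 < c.
  rewrite lt_neqAle sumr_ge0 ?andbT => [|i _]; last exact: sqr_ge0.
  apply: contra v0; rewrite eq_sym psumr_eq0 => [|i _]; last exact: sqr_ge0.
  move=> /allP c0; apply/eqP/rowP => i; rewrite [RHS]mxE.
  by have /= := c0 i (mem_index_enum _); rewrite sqrf_eq0 => /eqP.
pose u := (Num.sqrt c)^-1 *: v.
have uu : u *m u^T = 1%:M.
  apply/matrixP => i j; rewrite !ord1 !mxE eqxx.
  under eq_bigr do rewrite !mxE mulrACA -!expr2.
  rewrite -mulr_sumr -/c exprVn sqr_sqrtr ?ltW //.
  by rewrite mulVf ?gt_eqF.
have uS : u *m S = a *: u by rewrite -scalemxAl vS !scalerA mulrC.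
have [H HH Hu] := householder_row _ _ _ uu.
have HH' : H^T *m H = 1%:M by apply: mulmx1C.
(* In the basis formed by the rows of [H], which starts with the eigenvector [u], row 0 of the
   matrix is [a e_0]; symmetry clears column 0 as well and leaves a symmetric block of size [n]. *)
pose K : 'M[R]_(1 + n) := H *m S *m H^T.
have KT : K^T = K by rewrite /K !trmx_mul trmxK Ssym mulmxA.
have K0 : row 0 K = a *: delta_mx 0 0.
  rewrite /K -mulmxA row_mul Hu mulmxA uS -scalemxAl -Hu -row_mul HH.
  by congr (_ *: _); rewrite rowE mulmx1.
have KHS : K = H *m S *m H^T by [].
clearbody K.
have Kur : ursubmx K = 0.
  apply/matrixP => i j; have /rowP /(_ (rshift 1 j)) := K0.
  by rewrite !mxE ord1 /= mulr0 => <-; congr (K _ _); apply: val_inj.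
have Kul : ulsubmx K = a%:M.
  apply/matrixP => i j; have /rowP /(_ 0) := K0.
  by rewrite !mxE !ord1 /= mulr1 => <-; congr (K _ _); apply: val_inj.
have Kdl : dlsubmx K = 0 by rewrite -[K]KT -trmx_ursub Kur trmx0.
have drT : (drsubmx K)^T = drsubmx K by rewrite trmx_drsub KT.
case: (IH _ drT) => O1 [mu1 [OO1 SO1]].
pose L : 'M[R]_(1 + n) := block_mx 1%:M 0 0 O1.
have LL : L *m L^T = 1%:M.
  rewrite /L tr_block_mx mulmx_block !trmx0 !trmx1 OO1 !mulmx0 !mul0mx !mulmx1.
  by rewrite !addr0 !add0r scalar_mx_block.
exists (L *m H), (row_mx a%:M mu1); split.
  by rewrite trmx_mul mulmxA -(mulmxA L) HH mulmx1 LL.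
have KE : K = L^T *m diag_mx (row_mx a%:M mu1) *m L.
  rewrite -[LHS]submxK Kur Kul Kdl SO1 diag_mx_row /L tr_block_mx !mulmx_block.
  rewrite !trmx0 !trmx1 !mulmx0 !mul0mx !mulmx1 !mul1mx !addr0 !add0r mul0mx.
  congr (block_mx _ _ _ _); apply/matrixP => i j.
  by rewrite !ord1 !mxE.
have -> : (L *m H)^T *m diag_mx (row_mx a%:M mu1) *m (L *m H) = H^T *m K *m H.
  by rewrite KE trmx_mul !mulmxA.
by rewrite KHS !mulmxA HH' mul1mx -mulmxA HH' mulmx1.
Qed.

Lemma char_poly_orthogonal_diag (R : rcfType) n (O : 'M[R]_n) (mu : 'rV[R]_n) :
  O *m O^T = 1%:M ->
  char_poly (O^T *m diag_mx mu *m O) = \prod_i ('X - (mu 0 i)%:P).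
Proof.
move=> OO; have OO' : O^T *m O = 1%:M by apply: mulmx1C.
have cE : char_poly_mx (O^T *m diag_mx mu *m O) =
    map_mx polyC O^T *m char_poly_mx (diag_mx mu) *m map_mx polyC O.
  rewrite /char_poly_mx mulmxBr mulmxBl -!map_mxM /= [_ *m 'X%:M]scalar_mxC -mulmxA.
  rewrite -(mulmxA 'X%:M) -[X in _ *m X - _](map_mxM polyC O^T).
  by rewrite OO' map_mx1 mulmx1.
rewrite /char_poly cE !det_mulmx mulrAC -det_mulmx -map_mxM OO' map_mx1 det1 mul1r.
have -> : char_poly_mx (diag_mx mu) = diag_mx (\row_i ('X - (mu 0 i)%:P)).
  apply/matrixP => i j; rewrite !mxE; case: eqP => [->|_] //=.
  by rewrite !mulr0n polyC0 subr0.
by rewrite det_diag; apply: eq_bigr => i _; rewrite mxE.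
Qed.

(** The condition [f 0 = 1] hides the zero eigenvalues, so a product over eigenvalues with
    repetition regroups over the distinct nonzero ones, each raised to its algebraic
    multiplicity. *)
Lemma prod_eigenvalues (R : rcfType) N (S : 'M[R]_N) (mu : 'rV[R]_N) l
    (lam : 'I_l -> R) (r : 'I_l -> nat) (f : R -> R) :
  char_poly S = \prod_i ('X - (mu 0 i)%:P) ->
  injective lam ->
  (forall a : R, a != 0 -> (eigenvalue S a <-> exists i, lam i = a)) ->
  (forall i, r i = mup (lam i) (char_poly S)) ->
  f 0 = 1 ->
  \prod_i f (mu 0 i) = \prod_i f (lam i) ^+ r i.
Proof.
move=> cS lamI lamE rE f0.
have eigen_mu i : mu 0 i != 0 -> exists j, lam j = mu 0 i.
  move=> mu0; apply/lamE => //; rewrite eigenvalue_root_char cS.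
  rewrite (bigD1 i) //= rootM root_XsubC eqxx. done.
(* Each factor is spread over all [j] with a single nontrivial term; exchanging the products then
   counts how often [lam j] occurs among the [mu 0 i]. *)
have fE i : f (mu 0 i) = \prod_j (if lam j == mu 0 i then f (lam j) else 1).
  have [mu0|/eigen_mu [j <-]] := eqVneq (mu 0 i) 0.
    rewrite mu0 f0 big1 // => j _; case: eqP => [->|//]; exact: f0.
  rewrite (bigD1 j) //= eqxx big1 ?mulr1 // => k kj.
  by rewrite (inj_eq lamI) (negPf kj).
rewrite (eq_bigr _ (fun i _ => fE i)) exchange_big /=; apply: eq_bigr => j _.
rewrite -big_mkcond /= prodr_const rE cS -(big_map (mu 0) xpredT (fun y => 'X - y%:P)).
rewrite mu_prod_XsubC count_map -sum1_card -sum1_count.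
by congr (_ ^+ _); apply: eq_bigl => i; rewrite /= eq_sym.
Qed.

(** * The Fourier transform of the Gaussian function *)

Lemma is_derive_sin_scale (R : realType) (k x : R) :
  is_derive x 1 (fun y => sin (k * y)) (k * cos (k * x)).
Proof.
have h1 : is_derive x 1 (fun y : R => k * y) k.
  by apply: is_derive_eq; rewrite scaler1 ?mulr1.
by have := @is_derive1_comp _ sin _ x _ _ (is_derive_sin _) h1; rewrite mulrC.
Qed.

Lemma is_derive_cos_scale (R : realType) (k x : R) :
  is_derive x 1 (fun y => cos (k * y)) (- (k * sin (k * x))).
Proof.
have h1 : is_derive x 1 (fun y : R => k * y) k.
  by apply: is_derive_eq; rewrite scaler1 ?mulr1.
by have := @is_derive1_comp _ cos _ x _ _ (is_derive_cos _) h1; rewrite mulNr mulrC.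
Qed.

Lemma is_derive_gauss_fun (R : realType) (x : R) :
  is_derive x 1 (@gauss_fun R) (- (2 * x * gauss_fun x)).
Proof.
have h1 : is_derive x 1 (fun y : R => - y ^+ 2) (- (2 * x)).
  by apply: is_derive_eq; rewrite /GRing.scale /= mulr1; ring.
by have := @is_derive1_comp _ expR _ x _ _ (is_derive_expR _) h1;
  rewrite mulrN mulrC.
Qed.

Lemma integrable_bounded_mul d (T : measurableType d) (R : realType)
    (mu : {measure set T -> \bar R}) (f g : T -> R) (M : R) :
  mu.-integrable setT (EFin \o f) -> measurable_fun setT g ->
  (forall x, `|g x| <= M) -> mu.-integrable setT (EFin \o (fun x => f x * g x)).
Proof.
move=> fi mg gM.
have M0 (x : T) : 0 <= M by exact: le_trans (normr_ge0 _) (gM x).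
have mf : measurable_fun setT f by apply/measurable_EFinP; case/integrableP : fi.
apply: (@le_integrable _ _ _ _ _ measurableT _ (EFin \o (fun x => M * f x))).
- by apply/measurable_EFinP; apply: measurable_funM.
- move=> x _; rewrite /= lee_fin !normrM mulrC; apply: ler_wpM2r => //.
  by rewrite (ger0_norm (M0 x)).
- exact: (@integrableZl _ _ _ _ _ measurableT M _ fi).
Qed.

(** Half of the exponent absorbs the linear factor, by |x| <= 1 + x^2/2 <= exp (x^2/2); what remains
    is the unnormalized standard normal density, which is integrable. *)
Lemma normr_mul_gauss_fun_le (R : realType) (x : R) :
  `|x| * gauss_fun x <= normal_fun 0 1 x.
Proof.
rewrite /gauss_fun /normal_fun subr0 expr1n.
rewrite [in leLHS](_ : - x ^+ 2 = - x ^+ 2 / (1 *+ 2) + - x ^+ 2 / (1 *+ 2)); last by field.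
rewrite expRD mulrA -[leRHS]mul1r ler_wpM2r ?expR_ge0 //.
rewrite mulNr expRN ler_pdivrMr ?expR_gt0 // mul1r.
apply: le_trans (expR_ge1Dx _).
have := sqr_ge0 (`|x| - 1); rewrite sqrrB1 real_normK ?num_real //.
by rewrite -mulr_natr; lra.
Qed.

Lemma integrable_normal_fun (R : realType) :
  (@lebesgue_measure R).-integrable setT (EFin \o @normal_fun R 0 1).
Proof.
have /(@integrableZl _ _ _ _ _ measurableT (normal_peak 1)^-1%R) :=
  @integrable_normal_pdf R 0 1.
rewrite (_ : (fun _ => _) = EFin \o normal_fun 0 1) // .
apply/funext => x; rewrite /= normal_pdfE ?oner_neq0 // -EFinM mulKf //.
by rewrite gt_eqF // normal_peak_gt0 // oner_neq0.
Qed.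

Lemma measurable_scale_trig (R : realType) (k : R) :
  measurable_fun setT (fun y : R => sin (k * y)) /\
  measurable_fun setT (fun y : R => cos (k * y)).
Proof.
have mk : measurable_fun setT (fun y : R => k * y) by exact: measurable_funM.
split; apply: measurableT_comp mk; apply: continuous_measurable_fun.
  exact: continuous_sin.
exact: continuous_cos.
Qed.

(** Stands in for integration by parts on the whole line: the fundamental theorem on growing
    intervals, then dominated convergence. *)
Lemma Rintegral_deriv_eq0 (R : realType) (g g' : R -> R) :
  (forall x : R, is_derive x (1 : R) g (g' x)) -> continuous g' ->
  (@lebesgue_measure R).-integrable setT (EFin \o g') ->
  g n%:R @[n --> \oo] --> 0 -> g (- n%:R) @[n --> \oo] --> 0 ->
  \int[lebesgue_measure]_x g' x = 0.
Proof.
move=> dg cg ig gp gm; pose mu := @lebesgue_measure R.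
have cvg_g : continuous g.
  by move=> x; apply/differentiable_continuous/derivable1_diffP; exact: ex_derive.
(* The index [n.+1] keeps the interval nondegenerate at n = 0, as the fundamental theorem
   requires. *)
pose f_ n x := ((EFin \o g') \_ `[- n.+1%:R, n.+1%:R]%classic) x.
have mg : measurable_fun setT (EFin \o g').
  by case/integrableP : ig.
have [] := @dominated_convergence _ _ _ mu _ measurableT f_ (EFin \o g')
  (abse \o (EFin \o g')).
- move=> n; apply/(measurable_restrictT _ _).1 => //. exact: measurable_funTS.
- exact: mg.
- apply: aeW => x _.
  apply: cvg_near_cst; near=> n.
  rewrite /f_ patchE ifT // inE /= in_itv /= -ler_norml.
  have : `|x| < n%:R by near: n; apply: nbhs_infty_gtr.
  by move=> /ltW h; apply: le_trans h _; rewrite ler_nat.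
- exact: integrable_abse.
- apply: aeW => x n _; rewrite /f_ patchE; case: ifPn => // _.
  by rewrite abse0 abse_ge0.
move=> _ _; have -> : [sequence \int[mu]_x f_ n x]_n%E =
    (fun n => (g n.+1%:R - g (- n.+1%:R))%:E).
  apply/funext => n /=; rewrite -integral_mkcond.
  rewrite (@continuous_FTC2 _ g' g) ?EFinB //.
  - by rewrite -subr_gt0 opprK -natrD ltr0n addnS.
  - exact: continuous_subspaceT.
  - split=> [x _||]; first exact: ex_derive.
    + by apply: cvg_at_right_filter; exact: cvg_g.
    + by apply: cvg_at_left_filter; exact: cvg_g.
  - by move=> x _; rewrite derive1E; apply: derive_val.
move=> h; have h0 : (g n.+1%:R - g (- n.+1%:R))%:E @[n --> \oo] --> (0 : R)%:E.
  apply: cvg_EFin; first exact: nearW.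
  rewrite -[0](subr0 0); apply: cvgB.
    by have := gp; rewrite -cvg_shiftS.
  by have := gm; rewrite -cvg_shiftS.
by rewrite /Rintegral -(cvg_lim _ h) // (cvg_lim _ h0).
Unshelve. all: by end_near.
Qed.

Lemma integrable_gauss_deriv (R : realType) (h : R -> R) (M : R) :
  measurable_fun setT h -> (forall x, `|h x| <= M) ->
  (@lebesgue_measure R).-integrable setT (EFin \o (fun x => x * gauss_fun x * h x)).
Proof.
move=> mh hM; apply: (@integrable_bounded_mul _ _ _ (@lebesgue_measure R) (fun x => x * gauss_fun x) h M) => //.
apply: le_integrable (integrable_normal_fun R) => //.
  apply/measurable_EFinP; apply: measurable_funM => //.
  exact: measurable_gauss_fun.
move=> x _; rewrite /= lee_fin normrM (ger0_norm (gauss_fun_ge0 _)).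
by rewrite (ger0_norm (normal_fun_ge0 _ _ _)) normr_mul_gauss_fun_le.
Qed.

(** The sign [s] lets one statement serve both ends of the line. *)
Lemma cvg_gauss_sin_nat (R : realType) (c : R) (s : R) : `|s| = 1 ->
  gauss_fun (s * n%:R) * sin (c * (s * n%:R)) @[n --> \oo] --> (0 : R).
Proof.
move=> s1.
have gs n : gauss_fun (s * n%:R) = gauss_fun (n%:R : R).
  by rewrite /gauss_fun exprMn -[s ^+ 2]real_normK ?num_real // s1 expr1n mul1r.
have g0 : gauss_fun (n%:R : R) @[n --> \oo] --> (0 : R).
  apply: (cvg_comp (fun n : nat => n%:R : R) gauss_fun); last exact: cvg_gauss_fun.
  exact: cvgr_idn.
apply: norm_cvg0; apply: (@squeeze_cvgr _ _ _ _ (cst 0) _ _ _ _ _ g0).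
  apply: nearW => n; rewrite normr_ge0 /= normrM gs (ger0_norm (gauss_fun_ge0 _)).
  by rewrite ler_piMr ?gauss_fun_ge0 // ler_norml sin_geN1 sin_le1.
exact: cvg_cst.
Qed.

(** The derivative of exp (-x^2) sin (c x) integrates to 0. This identity is the differential
    equation of the transform in the next lemma. *)
Lemma Rintegral_gauss_sin (R : realType) (c : R) :
  2 * \int[lebesgue_measure]_x (x * gauss_fun x * sin (c * x)) =
  c * \int[lebesgue_measure]_x (gauss_fun x * cos (c * x)).
Proof.
have [ms mc] := measurable_scale_trig R c.
have sin1 (x : R) : `|sin (c * x)| <= 1 by rewrite ler_norml sin_geN1 sin_le1.
have cos1 (x : R) : `|cos (c * x)| <= 1 by rewrite ler_norml cos_geN1 cos_le1.
have i1 := integrable_gauss_deriv R _ 1 ms sin1.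
have i2 := integrable_bounded_mul _ _ _ _ _ _ _ (@integrableT_gauss R) mc cos1.
pose g' (x : R) := c * (gauss_fun x * cos (c * x)) - 2 * (x * gauss_fun x * sin (c * x)).
have i1' := @integrableZl _ _ _ _ _ measurableT 2 _ i1.
have i2' := @integrableZl _ _ _ _ _ measurableT c _ i2.
have : \int[lebesgue_measure]_x g' x = 0.
  apply: (@Rintegral_deriv_eq0 _ (fun x => gauss_fun x * sin (c * x))).
  - move=> x.
    have := @is_deriveM _ _ _ _ x 1 _ _ (is_derive_gauss_fun R x) (is_derive_sin_scale R c x).
    move=> h; apply: is_derive_eq; rewrite /g' /GRing.scale /=; ring.
  - move=> x; apply: differentiable_continuous; apply/derivable1_diffP.
    have dg := is_derive_gauss_fun R x.
    have dc := is_derive_cos_scale R c x.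
    have ds := is_derive_sin_scale R c x.
    by apply: ex_derive.
  - by apply: (integrableB measurableT i2' i1').
  - have := cvg_gauss_sin_nat R c 1 (normr1 _).
    by under eq_fun do rewrite mul1r.
  - have := cvg_gauss_sin_nat R c (-1) (normrN1 _).
    by under eq_fun do rewrite mulN1r.
rewrite RintegralB // !RintegralZl // => /eqP; rewrite subr_eq0 => /eqP.
by [].
Qed.

(** Differentiating under the integral, with |y| exp (-y^2) as dominating function, gives F' =
    -(x/2) F for the cosine transform [F]. Hence F(x) exp (x^2/4) is constant, equal to the Gaussian
    integral at 0. *)
Lemma Rintegral_gauss_cos (R : realType) (c : R) :
  \int[lebesgue_measure]_x (gauss_fun x * cos (2 * c * x)) =
  Num.sqrt pi * expR (- c ^+ 2).
Proof.
pose F (c : R) := \int[lebesgue_measure]_x (gauss_fun x * cos (c * x)).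
have sin1 (k x : R) : `|sin (k * x)| <= 1 by rewrite ler_norml sin_geN1 sin_le1.
have cos1 (k x : R) : `|cos (k * x)| <= 1 by rewrite ler_norml cos_geN1 cos_le1.
have dcos (y x : R) : is_derive x 1 (fun c => gauss_fun y * cos (c * y))
    (- (y * gauss_fun y * sin (x * y))).
  have h : is_derive x 1 (fun c : R => cos (y * c)) (- (y * sin (y * x))).
    exact: is_derive_cos_scale.
  rewrite (_ : (fun c => _) = (fun c => gauss_fun y * cos (y * c))); last first.
    by apply/funext => c'; rewrite (mulrC y).
  apply: is_derive_eq.
  by rewrite /GRing.scale /= (mulrC y x); ring.
have dF (x : R) : is_derive x 1 F (- (x / 2 * F x)).
  have Ix : `]x - 1, x + 1[%classic x by rewrite /= in_itv /=; apply/andP; split; lra.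
  have G0 (y : R) : 0 <= `|y| * gauss_fun y by rewrite mulr_ge0 // gauss_fun_ge0.
  have intf (z : R) : `]x - 1, x + 1[%classic z ->
      (@lebesgue_measure R).-integrable setT (EFin \o (fun y => gauss_fun y * cos (z * y))).
    move=> _; apply: (@integrable_bounded_mul _ _ _ (@lebesgue_measure R) gauss_fun _ 1) (cos1 z).
      exact: integrableT_gauss.
    exact: (measurable_scale_trig R z).2.
  have derf (z y : R) : `]x - 1, x + 1[%classic z -> setT y ->
      derivable ((fun c y => gauss_fun y * cos (c * y))^~ y) z 1.
    by move=> _ _; apply: ex_derive.
  have intG : (@lebesgue_measure R).-integrable setT
      (EFin \o (fun y : R => `|y| * gauss_fun y)).
    apply: le_integrable (integrable_normal_fun R) => //.
      apply/measurable_EFinP; apply: measurable_funM; last exact: measurable_gauss_fun.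
      exact: normr_measurable.
    move=> y _; rewrite /= lee_fin (ger0_norm (G0 y)).
    by rewrite (ger0_norm (normal_fun_ge0 _ _ _)) normr_mul_gauss_fun_le.
  have partE (z y : R) : partial1of2 (fun c y => gauss_fun y * cos (c * y)) z y
      = - (y * gauss_fun y * sin (z * y)).
    by rewrite partial1of2E; apply: derive_val.
  have Gub (z y : R) : `]x - 1, x + 1[%classic z -> setT y ->
      `|partial1of2 (fun c y => gauss_fun y * cos (c * y)) z y| <= `|y| * gauss_fun y.
    move=> _ _; rewrite partE normrN !normrM (ger0_norm (gauss_fun_ge0 _)).
    by rewrite ler_piMr.
  have dF := derivable_under_integral measurableT Ix intf derf G0 intG Gub.
  have eF := differentiation_under_integral measurableT Ix intf derf G0 intG Gub.
  apply: DeriveDef => //; rewrite -derive1E eF.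
  under eq_Rintegral do rewrite partE -mulN1r.
  rewrite RintegralZl //; last first.
    by apply: integrable_gauss_deriv (sin1 x); exact: (measurable_scale_trig R x).1.
  by have := Rintegral_gauss_sin R x; rewrite -/(F x); lra.
pose H (x : R) := F x * expR (x ^+ 2 / 4).
have dH (x : R) : is_derive x (1 : R) H 0.
  have h1 : is_derive x 1 (fun x : R => x ^+ 2 / 4) (x / 2).
    by apply: is_derive_eq; rewrite /GRing.scale /= mulr1; field.
  have h2 := @is_derive1_comp _ expR _ x _ _ (is_derive_expR _) h1.
  have h3 := @is_deriveM _ _ _ _ x 1 _ _ (dF x) h2.
  by apply: is_derive_eq; rewrite /GRing.scale /=; ring.
have := is_derive_0_is_cst (2 * c) 0 dH.
rewrite /H expr0n mul0r expR0 mulr1 /F => HE.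
have -> : Num.sqrt pi = \int[lebesgue_measure]_x (gauss_fun x * cos (0 * x)) :> R.
  rewrite /Rintegral; under eq_integral do rewrite mul0r cos0 mulr1.
  by rewrite integralT_gauss.
rewrite -HE -mulrA -expRD (_ : _ + _ = 0) ?expR0 ?mulr1 //.
by field.
Qed.

(** * Probability laws with a density, and independent chi-square variables *)

Section density.
Context d (T : measurableType d) (R : realType) (mu : {measure set T -> \bar R}).
Context (f : T -> R) (mf : measurable_fun setT f) (f_ge0 : forall x, 0 <= f x)
  (int_f : (\int[mu]_x (f x)%:E = 1)%E).

(* The hypotheses are arguments so that the measure instance below depends on them. *)
Definition density_measure
    of measurable_fun setT f & (forall x, 0 <= f x) & (\int[mu]_x (f x)%:E = 1)%E :=
  fun A : set T => (\int[mu]_(x in A) (f x)%:E)%E.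

Local Notation nu := (density_measure mf f_ge0 int_f).

Let nu0 : nu set0 = 0%E. Proof. exact: integral_set0. Qed.

Let nu_ge0 A : (0 <= nu A)%E.
Proof. by apply: integral_ge0 => x _; rewrite lee_fin. Qed.

Let nu_additive : semi_sigma_additive nu.
Proof.
move=> A mA tA mUA; rewrite /density_measure ge0_integral_bigcup //.
- apply: is_cvg_ereal_nneg_natsum_cond => n _ _; exact: nu_ge0.
- by apply: measurable_funTS; apply/measurable_EFinP.
- by move=> x _; rewrite lee_fin.
Qed.

HB.instance Definition _ := isMeasure.Build _ _ _ nu nu0 nu_ge0 nu_additive.

Let nu_setT : nu setT = 1%E. Proof. exact: int_f. Qed.

HB.instance Definition _ := Measure_isProbability.Build _ _ R nu nu_setT.

End density.

(** The change of variables goes through the Radon-Nikodym derivative, which agrees with [f] almost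
    everywhere because both have the same integral over every measurable set. *)
Lemma density_probability_exists d (T : measurableType d) (R : realType)
    (mu : {sigma_finite_measure set T -> \bar R}) (f : T -> R) :
  measurable_fun setT f -> (forall x, 0 <= f x) -> (\int[mu]_x (f x)%:E = 1)%E ->
  exists nu : probability T R,
    (forall A, measurable A -> nu A = (\int[mu]_(x in A) (f x)%:E)%E) /\
    (forall g : T -> R, measurable_fun setT g -> (forall x, 0 <= g x <= 1) ->
      (\int[nu]_x (g x)%:E = \int[mu]_x (g x * f x)%:E)%E).
Proof.
move=> mf f0 if1; pose nu : probability T R := density_measure _ _ _ mu f mf f0 if1.
have nuE A : nu A = (\int[mu]_(x in A) (f x)%:E)%E by [].
exists nu; split => // g mg g01.
have dom : nu `<< mu.
  apply/null_content_dominatesP => A mA muA0; rewrite nuE null_set_integral //.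
  by apply: measurable_funTS; apply/measurable_EFinP.
have fi : mu.-integrable setT (EFin \o f).
  apply/integrableP; split; first exact/measurable_EFinP.
  under eq_integral do rewrite gee0_abs ?lee_fin //.
  by rewrite [ltLHS]if1 ltry.
have gi : nu.-integrable setT (EFin \o g).
  apply: (@le_integrable _ _ _ _ _ measurableT _ (cst 1%E)).
  - exact/measurable_EFinP.
  - move=> x _; rewrite /= normr1 lee_fin ger0_norm; by case/andP: (g01 x).
  - exact: finite_measure_integrable_cst.
rewrite -(Radon_Nikodym_change_of_variables dom measurableT gi).
apply: ae_eq_integral => //.
- apply: emeasurable_funM; first exact/measurable_EFinP.
  by apply: (measurable_int mu); apply: Radon_Nikodym_integrable.
- by apply/measurable_EFinP; apply: measurable_funM.
- under [X in ae_eq _ _ _ X]eq_fun do rewrite EFinM.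
  apply: (@ae_eqe_mul2l _ _ _ _ _ _ _ (EFin \o g)) => /=.
  rewrite Radon_NikodymE //=.
  case: cid => h [h1 h2 h3] /=.
  apply: integral_ae_eq => //=; first exact/measurable_EFinP.
  by move=> E _ mE; rewrite -h3.
Qed.

(** By uniqueness, [k] times the image of Lebesgue measure under multiplication by [k] is Lebesgue
    measure, since the two agree on half-open intervals. *)
Lemma ge0_integral_scale (R : realType) (k : R) (g : R -> R) : 0 < k ->
  measurable_fun setT g -> (forall x, 0 <= g x) ->
  (\int[lebesgue_measure]_x (g (k * x))%:E =
   (k^-1)%:E * \int[lebesgue_measure]_x (g x)%:E)%E.
Proof.
move=> k0 mg g0.
have mk : measurable_fun setT (fun y : R => k * y) by exact: measurable_funM.
pose kn : {nonneg R} := NngNum (ltW k0).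
pose mu0 : {measure set (measurableTypeR R) -> \bar R} :=
  mscale kn (pushforward (@lebesgue_measure R)
    (fun y : measurableTypeR R => k * y : measurableTypeR R)).
pose mu' := mu0 mk; have muE (A : set R) : measurable A -> lebesgue_measure A = mu' A.
  apply: lebesgue_measure_unique => X [[a b] /= ab <-].
  pose I : set R := `]k^-1 * a, k^-1 * b]%classic.
  transitivity (k%:E * @lebesgue_measure R I)%E.
    rewrite /I !lebesgue_measure_itv /= !lte_fin ltr_pM2l ?invr_gt0 //.
    case: ifPn => _; last by rewrite mule0.
    by rewrite -!EFinB -EFinM -mulrBr mulVKf ?gt_eqF.
  congr (_ * lebesgue_measure _)%E.
  by apply/seteqP; split => y; rewrite /I /= !in_itv /= ltr_pdivrMl // ler_pdivlMl.
rewrite [in RHS](eq_measure_integral mu'); last by move=> A mA _; exact: muE.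
rewrite ge0_integral_mscale //=; [|exact/measurable_EFinP|by move=> x _; rewrite lee_fin].
rewrite ge0_integral_pushforward //=; [|exact/measurable_EFinP|by move=> x _; rewrite lee_fin].
rewrite muleA -EFinM mulVf ?gt_eqF // mul1e preimage_setT. done.
Qed.

Lemma chi2_dens_ge0 (R : realType) r (x : R) : 0 <= chi2_dens r x.
Proof. by rewrite mulr_ge0 // ?powR_ge0 ?expR_ge0. Qed.

Lemma measurable_chi2_dens (R : realType) r : measurable_fun setT (@chi2_dens R r).
Proof.
apply: measurable_funM; first exact: measurable_powR.
by apply: measurableT_comp => //; apply: measurable_funM => //; exact: oppr_measurable.
Qed.

(** With u = sqrt x the density is x^(-1/2) u^r exp (-u^2/2). The constant comes from u^r (1 + u)^2
    <= (1 + u)^(r+2) <= (r+2)! exp (1 + u) and 1 + u - u^2/2 <= 3/2. The majorant is chosen for its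
    elementary primitive -2 / (1 + sqrt x). *)
Lemma chi2_dens_le (R : realType) (r : nat) (x : R) : 0 < x ->
  chi2_dens r.+1 x <=
  (r.+2`!%:R * expR (3 / 2)) * (x `^ (- 2^-1) / (1 + x `^ 2^-1) ^+ 2).
Proof.
move=> x0; have u0 : 0 < x `^ 2^-1 by rewrite powR_gt0.
have xE : x = (x `^ 2^-1) ^+ 2.
  by rewrite -powR_mulrn ?powR_ge0 // -powRrM mulVf // powRr1 // ltW.
have -> : chi2_dens r.+1 x =
    x `^ (- 2^-1) * ((x `^ 2^-1) ^+ r * expR (- (x `^ 2^-1) ^+ 2 / 2)).
  rewrite -xE mulrA; congr (_ * _).
  rewrite -powR_mulrn ?powR_ge0 // -powRrM -powRD; last by rewrite (gt_eqF x0) implybT.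
  by congr (_ `^ _); rewrite -natr1; field.
move: (x `^ 2^-1) u0 => u u0 {xE}.
rewrite [leRHS]mulrCA ler_wpM2l ?powR_ge0 // ler_pdivlMr ?exprn_gt0 ?addr_gt0 //.
have h1 : u ^+ r * (1 + u) ^+ 2 <= (1 + u) ^+ r.+2.
  by rewrite -[in leRHS](addn2 r) exprD ler_wpM2r ?sqr_ge0 // lerXn2r ?nnegrE; lra.
have h2 : (1 + u) ^+ r.+2 <= r.+2`!%:R * expR (1 + u).
  rewrite mulrC -ler_pdivrMr ?ltr0n ?fact_gt0 //.
  apply: le_trans (expR_ge1Dxn r.+1 _); last by rewrite addr_ge0 // ltW.
  by rewrite lerDr.
rewrite mulrAC; apply: (@le_trans _ _ (r.+2`!%:R * expR (1 + u) * expR (- u ^+ 2 / 2))).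
  by rewrite ler_wpM2r ?expR_ge0 // (le_trans h1 h2).
rewrite -mulrA -expRD ler_wpM2l // ler_expR.
by have := sqr_ge0 (u - 1); rewrite sqrrB1; lra.
Qed.

Lemma chi2_bound_primitive (R : realType) (x : R) : 0 < x ->
  is_derive x 1 (fun x => - 2 * (1 + x `^ 2^-1)^-1)
    (x `^ (- 2^-1) / (1 + x `^ 2^-1) ^+ 2).
Proof.
move=> x0; have u0 : 0 < 1 + x `^ 2^-1 by rewrite addr_gt0 ?powR_gt0.
have h1 := is_derive1_powR 2^-1 x0.
have h3 : is_derive x 1 (fun x : R => 1 + x `^ 2^-1) (2^-1 * x `^ (2^-1 - 1)).
  by apply: is_derive_eq; rewrite add0r mul1r.
have h4 := @is_deriveV _ (fun x : R => 1 + x `^ 2^-1) x _ _ (lt0r_neq0 u0) h3.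
apply: is_derive_eq; rewrite /GRing.scale /=.
rewrite (_ : 2^-1 - 1 = - 2^-1); last by field.
by field; rewrite gt_eqF.
Qed.

Lemma chi2_mass_lty (R : realType) (r : nat) : (0 < r)%N ->
  (\int[lebesgue_measure]_(x in `]0%R, +oo[) (@chi2_dens R r x)%:E < +oo)%E.
Proof.
case: r => // r _; pose mu := @lebesgue_measure R.
set K : R := r.+2`!%:R * expR (3 / 2).
have K0 : 0 <= K by rewrite mulr_ge0 // expR_ge0.
(* Compact intervals avoid the possible singularity at 0; [n.+2] makes the two endpoints distinct
   already at n = 0. *)
pose F (n : nat) : set R := `[n.+2%:R^-1, n.+2%:R]%classic.
have F_gt0 n x : F n x -> 0 < x.
  by rewrite /F /= in_itv /= => /andP[h _]; apply: lt_le_trans h; rewrite invr_gt0.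
have -> : `]0%R, +oo[%classic = \bigcup_n F n.
  apply/seteqP; split => x /=; last by move=> [n _ /F_gt0]; rewrite in_itv /= andbT.
  rewrite in_itv /= andbT => x0.
  have [n nx] : exists n : nat, x + x^-1 < n%:R.
    by exists (Num.bound (x + x^-1)); apply: archi_boundP; rewrite addr_ge0 ?invr_ge0 // (ltW x0).
  have nn : n%:R < n.+2%:R :> R by rewrite ltr_nat.
  have xi : 0 < x^-1 by rewrite invr_gt0.
  exists n => //; rewrite /F /= in_itv /=; apply/andP; split; last by lra.
  rewrite -[leRHS]invrK lef_pV2 ?posrE ?invr_gt0 //; lra.
have mF n : measurable (F n) by exact: measurable_itv.
have cv : (\int[lebesgue_measure]_(x in F i) (@chi2_dens R r.+1 x)%:E)%E @[i --> \oo]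
    --> (\int[lebesgue_measure]_(x in \bigcup_i F i) (@chi2_dens R r.+1 x)%:E)%E.
  apply: ge0_nondecreasing_set_cvg_integral => //.
  - move=> n p np; apply/subsetPset => x; rewrite /F /= !in_itv /= => /andP[h1 h2].
    apply/andP; split; last by apply: le_trans h2 _; rewrite ler_nat.
    by apply: le_trans h1; rewrite lef_pV2 ?posrE // ler_nat.
  - move=> n; apply: measurable_funTS; apply/measurable_EFinP.
    exact: measurable_chi2_dens.
  - by move=> n x _; rewrite lee_fin chi2_dens_ge0.
(* The primitive of the majorant stays between -2 and 0, so no exhausting integral exceeds
   [2 * K]. *)
apply: (@le_lt_trans _ _ (2 * K)%:E); last exact: ltry.
rewrite -(cvg_lim _ cv) //.
apply: lime_le; first by apply/cvg_ex; eexists; exact: cv.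
  apply: nearW => n.
  pose f (x : R) := x `^ (- 2^-1) / (1 + x `^ 2^-1) ^+ 2.
  have cf : {within F n, continuous f}.
    apply: derivable_within_continuous => x; rewrite in_itv /= => /andP[xn _].
    have x0 : 0 < x by apply: lt_le_trans xn; rewrite invr_gt0.
    have h1 := is_derive1_powR 2^-1 x0; have h2 := is_derive1_powR (- 2^-1) x0.
    have h3 : is_derive x 1 (fun x : R => (1 + x `^ 2^-1) ^+ 2)
      (2 * (1 + x `^ 2^-1) * (2^-1 * x `^ (2^-1 - 1))).
      by apply: is_derive_eq; rewrite /GRing.scale /= add0r; ring.
    have u0 : (1 + x `^ 2^-1) ^+ 2 != 0.
      by rewrite expf_neq0 // gt_eqF // addr_gt0 ?powR_gt0.
    have h4 := @is_deriveV _ (fun x : R => (1 + x `^ 2^-1) ^+ 2) x _ _ u0 h3.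
    exact: ex_derive.
  have mf : measurable_fun (F n) (EFin \o f).
    by apply/measurable_EFinP; apply: subspace_continuous_measurable_fun.
  apply: (@le_trans _ _ (\int[mu]_(x in F n) (K%:E * (f x)%:E))%E).
    apply: ge0_le_integral => //.
    + exact: mF.
    + by move=> x _; rewrite lee_fin chi2_dens_ge0.
    + by apply: measurable_funTS; apply/measurable_EFinP; exact: measurable_chi2_dens.
    + by apply: measurable_funeM.
    + by move=> x /F_gt0 x0; rewrite -EFinM lee_fin; exact: chi2_dens_le.
  rewrite ge0_integralZl //; last first.
    by move=> x _; rewrite lee_fin mulr_ge0 ?powR_ge0 ?invr_ge0 ?sqr_ge0.
    exact: mF.
  rewrite (@continuous_FTC2 _ f (fun x => - 2 * (1 + x `^ 2^-1)^-1)).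
  + rewrite -EFinB -EFinM lee_fin mulrC ler_wpM2r //.
    have h1 : (1 + n.+2%:R^-1 `^ 2^-1)^-1 <= 1 :> R.
      by rewrite invf_le1 ?lerDl ?ltr_pwDl // powR_ge0.
    have h2 : 0 <= (1 + n.+2%:R `^ 2^-1)^-1 :> R.
      by rewrite invr_ge0 addr_ge0 // powR_ge0.
    by lra.
  + by rewrite (@lt_trans _ _ 1) // ?invf_lt1 ?ltr1n.
  + exact: cf.
  + have dG x : 0 < x -> derivable (fun x : R => - 2 * (1 + x `^ 2^-1)^-1) x 1.
      by move=> x0; have := chi2_bound_primitive R x x0 => h; apply: ex_derive.
    have cG x : 0 < x -> {for x, continuous (fun x : R => - 2 * (1 + x `^ 2^-1)^-1)}.
      by move=> x0; apply/differentiable_continuous/derivable1_diffP; exact: dG.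
    split.
    * move=> x; rewrite in_itv /= => /andP[xn _]; apply: dG.
      by apply: lt_trans xn; rewrite invr_gt0.
    * by apply: cvg_at_right_filter; apply: cG; rewrite invr_gt0.
    * by apply: cvg_at_left_filter; apply: cG.
  + move=> x; rewrite in_itv /= => /andP[xn _].
    have x0 : 0 < x by apply: lt_trans xn; rewrite invr_gt0.
    have := chi2_bound_primitive R x x0 => h.
    by rewrite derive1E; apply: derive_val.
Qed.

Lemma chi2_mass_gt0 (R : realType) (r : nat) :
  (0 < \int[lebesgue_measure]_(x in `]0%R, +oo[) (@chi2_dens R r x)%:E)%E.
Proof.
(* On [1, 2] the density is at least [c], by x^(r/2-1) >= x^(-1) >= 1/2 and exp (-x/2) >= exp
   (-1). *)
pose mu := @lebesgue_measure R; pose c : R := 2^-1 * expR (- 1).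
apply: (@lt_le_trans _ _ (\int[mu]_(x in `[1%R, 2%R]) c%:E)%E).
  rewrite integral_cst //= lebesgue_measure_itv /= lte_fin ltr1n -EFinB -EFinM lte_fin.
  by rewrite !mulr_gt0 ?expR_gt0 ?invr_gt0 // subr_gt0 ltr1n.
apply: (@le_trans _ _ (\int[mu]_(x in `[1%R, 2%R]) (@chi2_dens R r x)%:E)%E).
  apply: ge0_le_integral => //.
  - by move=> x _; rewrite lee_fin mulr_ge0 ?expR_ge0.
  - by apply: measurable_funTS; apply/measurable_EFinP; exact: measurable_chi2_dens.
  - move=> x; rewrite /= in_itv /= => /andP[x1 x2]; rewrite lee_fin.
    have x0 : 0 < x by apply: lt_le_trans x1.
    apply: ler_pM; rewrite ?expR_ge0 ?invr_ge0 //; last by rewrite ler_expR; lra.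
    apply: (@le_trans _ _ (x `^ (- 1))); last first.
      by apply: ler_powR => //; have : 0 <= r%:R :> R by []; lra.
    by rewrite powR_inv1 ?(ltW x0) // lef_pV2 ?posrE.
apply: ge0_subset_integral => //.
- by apply: measurable_funTS; apply/measurable_EFinP; exact: measurable_chi2_dens.
- by move=> x _; rewrite lee_fin chi2_dens_ge0.
- by move=> x /=; rewrite !in_itv /= andbT => /andP[x1 _]; apply: lt_le_trans x1.
Qed.

(** The substitution y = (1 + 2s) x absorbs exp (-s x) into the density up to a power of 1 + 2s. The
    transform is thus known relative to the total mass, without any value of the Gamma function. *)
Lemma chi2_laplace_mass (R : realType) (r : nat) (s : R) : 0 <= s ->
  (\int[lebesgue_measure]_(x in `]0%R, +oo[) (expR (- s * x) * chi2_dens r x)%:E =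
   ((Num.sqrt (1 + 2 * s))^-1 ^+ r)%:E *
   \int[lebesgue_measure]_(x in `]0%R, +oo[) (chi2_dens r x)%:E)%E.
Proof.
move=> s0; set k := 1 + 2 * s; have k0 : 0 < k by rewrite /k; lra.
have resE (f : R -> R) : (\int[lebesgue_measure]_(x in `]0%R, +oo[) (f x)%:E =
    \int[lebesgue_measure]_x (f x * \1_(`]0%R, +oo[%classic) x)%:E)%E.
  rewrite integral_mkcond; apply: eq_integral => x _; rewrite patchE indicE.
  by case: ifPn => _; rewrite ?mulr1 ?mulr0.
pose g (x : R) := chi2_dens r x * \1_(`]0%R, +oo[%classic) x.
have mg : measurable_fun setT g.
  by apply: measurable_funM; [exact: measurable_chi2_dens|exact: measurable_indic].
have g0 x : 0 <= g x by rewrite mulr_ge0 ?chi2_dens_ge0.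
have := ge0_integral_scale R k g k0 mg g0; rewrite -resE => gE.
pose c : R := k `^ (r%:R / 2 - 1); have c0 : 0 < c by rewrite powR_gt0.
have gkE (x : R) : g (k * x) = c * (expR (- s * x) * chi2_dens r x * \1_(`]0%R, +oo[%classic) x).
  rewrite /g !indicE !mem_setE /= !in_itv /= !andbT pmulr_rgt0 //.
  case: ltP => [x0|_]; last by rewrite !mulr0.
  have eE : expR (- (k * x) / 2) = expR (- s * x) * expR (- x / 2).
    by rewrite -expRD; congr expR; rewrite /k; field.
  rewrite !mulr1 /chi2_dens powRM ?(ltW k0) ?(ltW x0) // eE -/c; ring.
rewrite (resE (fun x => expR (- s * x) * chi2_dens r x)); move: gE; under eq_integral do rewrite gkE EFinM.
rewrite ge0_integralZl //; last first.
- by rewrite lee_fin ltW.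
- move=> x _; rewrite lee_fin; apply: mulr_ge0 => //.
  by apply: mulr_ge0; rewrite ?expR_ge0 ?chi2_dens_ge0.
- apply/measurable_EFinP; apply: measurable_funM; last exact: measurable_indic.
  apply: measurable_funM; last exact: measurable_chi2_dens.
  by apply: measurableT_comp => //; exact: measurable_funM.
move=> /(congr1 (fun z => (c^-1)%:E * z)%E); rewrite !muleA -!EFinM mulVf ?gt_eqF //.
rewrite mul1e => ->; congr (_%:E * _)%E.
rewrite exprVn -invfM; congr (_^-1).
rewrite -powR12_sqrt ?(ltW k0) // -powR_mulrn ?powR_ge0 // -powRrM.
rewrite -[X in _ * X = _](powRr1 (ltW k0)) /c -powRD; last by rewrite (gt_eqF k0) implybT.
by congr (_ `^ _); field.
Qed.

(** The law charges only the open half-line, so its transform may be written with |x|; this suits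
    variables that are later made nonnegative at every point by taking absolute values. *)
Lemma chi2_law_exists (R : realType) (r : nat) : (0 < r)%N ->
  exists nu : probability (measurableTypeR R) R,
    [/\ forall A, measurable A -> nu A =
          ((fine (\int[lebesgue_measure]_(y in `]0%R, +oo[) (@chi2_dens R r y)%:E))^-1%:E *
           \int[lebesgue_measure]_(x in A `&` `]0%R, +oo[) (chi2_dens r x)%:E)%E &
        forall s, 0 <= s -> (\int[nu]_x (expR (- s * `|x|))%:E =
          ((Num.sqrt (1 + 2 * s))^-1 ^+ r)%:E)%E].
Proof.
move=> r0; set I := (\int[_]_(_ in _) _)%E; set D : set R := `]0%R, +oo[%classic.
have Ifin : I \is a fin_num.
  by rewrite ge0_fin_numE ?chi2_mass_lty // integral_ge0 // => x _; rewrite lee_fin chi2_dens_ge0.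
set M := fine I; have IE : I = M%:E by rewrite fineK.
have M0 : 0 < M by rewrite -lte_fin -IE chi2_mass_gt0.
pose f (x : R) := M^-1 * chi2_dens r x * \1_D x.
have mD : measurable D by exact: measurable_itv.
have mf : measurable_fun setT f.
  apply: measurable_funM; last by apply: measurable_indic; exact: measurable_itv.
  by apply: measurable_funM => //; exact: measurable_chi2_dens.
have f0 x : 0 <= f x.
  apply: mulr_ge0 => //; apply: mulr_ge0; rewrite ?chi2_dens_ge0 //.
  by rewrite invr_ge0 ltW.
have intf (A : set R) (h : R -> R) : measurable A -> measurable_fun setT h ->
    (forall x, 0 <= h x) ->
  (\int[lebesgue_measure]_(x in A) (h x * f x)%:E = M^-1%:E *
    \int[lebesgue_measure]_(x in A `&` D) (h x * chi2_dens r x)%:E)%E.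
  move=> mA mh h0; rewrite -ge0_integralZl //.
  - rewrite setIC integral_mkcondl; apply: eq_integral => x _.
    rewrite patchE /f indicE; case: ifPn => _; last by rewrite !mulr0.
    by rewrite mulr1 -EFinM; congr (_%:E); ring.
  - exact: (measurableI _ _ mA mD).
  - by apply: measurable_funTS; apply/measurable_EFinP; apply: measurable_funM => //; exact: measurable_chi2_dens.
  - by move=> x _; rewrite lee_fin mulr_ge0 ?chi2_dens_ge0.
  - by rewrite lee_fin invr_ge0 ltW.
have intf1 (A : set R) : measurable A -> (\int[lebesgue_measure]_(x in A) (f x)%:E = M^-1%:E *
    \int[lebesgue_measure]_(x in A `&` D) (chi2_dens r x)%:E)%E.
  move=> mA; have := intf A (cst 1) mA (measurable_cst _) (fun _ => ler01).
  by under eq_integral do rewrite mul1r; under [in X in _ = X -> _]eq_integral do rewrite mul1r.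
have totf : (\int[lebesgue_measure]_x (f x)%:E = 1)%E.
  by rewrite intf1 // setTI -/I IE -EFinM mulVf // gt_eqF.
have [nu [nuE nuI]] := density_probability_exists _ _ _ lebesgue_measure f mf f0 totf.
exists nu; split => [A mA|s s0]; first by rewrite nuE // intf1.
have me : measurable_fun setT (fun x : R => expR (- s * `|x|)).
  apply: measurableT_comp => //; apply: measurable_funM => //; exact: normr_measurable.
rewrite nuI //; last first.
  by move=> x; rewrite expR_ge0 /= -expR0 ler_expR mulNr oppr_le0 mulr_ge0.
rewrite intf //.
rewrite setTI (_ : integral _ _ _ = ((Num.sqrt (1 + 2 * s))^-1 ^+ r)%:E * I)%E.
  by rewrite IE muleCA -EFinM mulVf ?gt_eqF //= mulr1.
rewrite -chi2_laplace_mass //; apply: eq_integral => x; rewrite inE /D /= in_itv /= andbT.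
by move=> x0; rewrite gtr0_norm.
Qed.

(** Product measures, one factor at a time. Independence is stated as factorization of expectations
    because both uses need it: indicators give independent events, exponentials give the Laplace
    transform of a sum. *)
Lemma independent_family_exists (R : realType) (l : nat)
    (nu : 'I_l -> probability (measurableTypeR R) R) :
  exists (d : measure_display) (T : measurableType d) (Q : probability T R)
         (C : 'I_l -> T -> R),
    (forall i, measurable_fun setT (C i)) /\
    (forall f : 'I_l -> R -> R, (forall i, measurable_fun setT (f i)) ->
       (forall i x, 0 <= f i x) ->
       (\int[Q]_w (\prod_i f i (C i w))%:E = \prod_i \int[nu i]_x (f i x)%:E)%E).
Proof.
elim: l nu => [|l IH] nu.
  (* With no variable to carry, any probability space serves. *)
  exists _, (measurableTypeR R), (normal_prob 0 1), (fun _ _ => 0).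
  split=> [[]//|f mf f0]; rewrite big_ord0.
  rewrite (eq_integral (cst 1%E)) => [|w _ //].
  by rewrite big_ord0 integral_cst //= probability_setT mule1.
have [d [T [Q [C [mC CE]]]]] := IH (fun i => nu (lift ord0 i)).
pose C1 (i : 'I_l.+1) (w : T * R) := if unlift ord0 i is Some j then C j w.1 else w.2.
exists _, (T * measurableTypeR R)%type, (Q \x nu ord0)%E, C1; split.
  move=> i; rewrite /C1; case: unliftP => [j _|_]; last exact: measurable_snd.
  exact: measurableT_comp.
move=> f mf f0.
have m1 : measurable_fun setT (fun w : T => \prod_(i < l) f (lift ord0 i) (C i w)).
  by apply: measurable_prod => i _; apply: measurableT_comp.
have f1 (w : T) : 0 <= \prod_(i < l) f (lift ord0 i) (C i w).
  by apply: prodr_ge0 => i _.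
have fE (w : T * R) : \prod_i f i (C1 i w) =
    f ord0 w.2 * \prod_(i < l) f (lift ord0 i) (C i w.1).
  rewrite big_ord_recl /C1 unlift_none; congr (_ * _).
  by apply: eq_bigr => i _; rewrite liftK.
rewrite fubini_tonelli1 /=.
- rewrite /fubini_F /=.
  transitivity (\int[Q]_w ((\prod_(i < l) f (lift ord0 i) (C i w))%:E *
      \int[nu ord0]_x (f ord0 x)%:E))%E.
    apply: eq_integral => w _; rewrite -ge0_integralZl //.
    - by apply: eq_integral => x _; rewrite fE EFinM muleC.
    - by apply/measurable_EFinP; exact: mf.
    - by move=> x _; rewrite lee_fin.
    - by rewrite lee_fin.
  rewrite ge0_integralZr //; last 3 first.
  - exact/measurable_EFinP.
  - by move=> w _; rewrite lee_fin.
  - by apply: integral_ge0 => x _; rewrite lee_fin.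
  by rewrite (CE (fun i => f (lift ord0 i))) // big_ord_recl muleC.
- apply/measurable_EFinP; under eq_fun do rewrite fE.
  apply: measurable_funM; first exact: measurableT_comp.
  by apply: (measurableT_comp m1).
- by move=> w; rewrite lee_fin prodr_ge0.
Qed.

Lemma chi2_family_exists (R : realType) (l : nat) (r : 'I_l -> nat) :
  (forall i, (0 < r i)%N) ->
  exists (d : measure_display) (T : measurableType d) (Q : probability T R)
         (C : 'I_l -> T -> R),
    [/\ (forall i, measurable_fun setT (C i)) /\ (forall i w, 0 <= C i w),
        independent_rvs Q C, (forall i, is_chi2 (r i) Q (C i)) &
        forall s : 'I_l -> R, (forall i, 0 <= s i) ->
          (\int[Q]_w (expR (- \sum_i s i * C i w))%:E =
           (\prod_i (Num.sqrt (1 + 2 * s i))^-1 ^+ r i)%:E)%E].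
Proof.
move=> r0.
have [nu nuP] := choice (fun i => chi2_law_exists R (r i) (r0 i)).
have [d [T [Q [C0 [mC0 CE]]]]] := independent_family_exists R l nu.
(* The absolute value leaves the law unchanged, as the law lives on the positive half-line, and
   gives nonnegativity everywhere rather than almost surely. *)
pose C i w := `|C0 i w|.
have mC i : measurable_fun setT (C i) by apply: measurableT_comp => //; exact: normr_measurable.
have mabs : measurable_fun setT (fun x : R => `|x|) by exact: normr_measurable.
have mpre (B : set R) : measurable B -> measurable [set x : R | B `|x|].
  by move=> mB; have := mabs measurableT B mB; rewrite setTI.
have indE (B : 'I_l -> set R) : (forall i, measurable (B i)) ->
    (Q (\bigcap_(i in [set: 'I_l]) (C i @^-1` B i)) = \prod_i nu i [set x : R | B i `|x|%R])%E.
  move=> mB.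
  have mC1 i : measurable (C i @^-1` B i).
    by have := mC i measurableT _ (mB i); rewrite setTI.
  transitivity (\prod_i \int[nu i]_x (\1_[set x : R | B i `|x|%R] x)%:E)%E; last first.
    by apply: eq_bigr => i _; rewrite integral_indic ?setIT //; exact: mpre.
  rewrite -(CE (fun i => \1_[set x : R | B i `|x|])) //; last first.
    by move=> i; apply: measurable_indic; exact: mpre.
  transitivity (\int[Q]_w (\1_(\bigcap_(i in [set: 'I_l]) (C i @^-1` B i)) w)%:E)%E.
    by rewrite integral_indic ?setIT //; exact: fin_bigcap_measurable.
  apply: eq_integral => w _; congr (_%:E); rewrite indicE.
  have [|] := boolP (w \in _).
    rewrite inE => h; rewrite big1 // => i _; rewrite indicE mem_set //=.
    exact: h.
  rewrite notin_setE => h; apply/esym/eqP/prodf_eq0.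
  have [i hi] : exists i, ~ B i (C i w) by apply: contrapT => h'; apply: h => i _; apply: contrapT => h2; apply: h'; exists i.
  by exists i => //; rewrite indicE memNset.
have ind1 i (B : set R) : measurable B -> (Q (C i @^-1` B) = nu i [set x : R | B `|x|%R])%E.
  (* The marginal law is read off the joint one by leaving all other coordinates unconstrained. *)
  move=> mB; pose B1 j := if j == i then B else setT.
  have mB1 j : measurable (B1 j) by rewrite /B1; case: ifP.
  have := indE B1 mB1; rewrite (bigD1 i) //= big1 => [|j ji]; last first.
    by rewrite /B1 (negPf ji) probability_setT.
  rewrite mule1 {2}/B1 eqxx => <-; congr (Q _).
  apply/seteqP; split=> [w Bw j _|w /(_ i Logic.I)]; rewrite /B1 /= ?eqxx //.
  by case: eqP => // ->.
exists d, T, Q, C; split=> //.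
- by split=> // i w; apply: normr_ge0.
- move=> B mB; rewrite indE //; apply: eq_bigr => i _; rewrite ind1 //.
- move=> i x; rewrite /prb.
  have -> : [set w | C i w <= x] = C i @^-1` `]-oo, x]%classic.
    by apply/seteqP; split=> w; rewrite /= in_itv.
  have mx : measurable [set y : R | `]-oo, x]%classic `|y|] by exact: mpre.
  have [nuE _] := nuP i; rewrite ind1 // (nuE _ mx).
  have Ifin (D : set R) : measurable D -> D `<=` `]0%R, +oo[%classic ->
      (\int[lebesgue_measure]_(y in D) (@chi2_dens R (r i) y)%:E)%E \is a fin_num.
    move=> mD D0; rewrite ge0_fin_numE; last first.
      by apply: integral_ge0 => y _; rewrite lee_fin chi2_dens_ge0.
    apply: le_lt_trans (chi2_mass_lty R (r i) (r0 i)); apply: ge0_subset_integral => //.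
      by apply: measurable_funTS; apply/measurable_EFinP; exact: measurable_chi2_dens.
    by move=> y _; rewrite lee_fin chi2_dens_ge0.
  rewrite fineM //; last first.
    apply: Ifin; last exact: subIsetr.
    by apply: measurableI => //; apply: mpre.
  rewrite mulrC; congr (fine (integral _ _ _) / _).
  apply/seteqP; split=> y /=; rewrite !in_itv /= ?andbT.
    by move=> [yx y0]; rewrite y0 -(gtr0_norm y0).
  by move=> /andP[y0 yx]; rewrite gtr0_norm.
- move=> s s0.
  have := CE (fun i x => expR (- s i * `|x|)) _ _.
  under [X in (_ = X)%E]eq_bigr => i _.
    have [_ -> //] := nuP i; first over.
  rewrite -prodEFin => <-.
  + by apply: eq_integral => w _; rewrite -expR_sum -sumrN; congr (expR _)%:E;
      apply: eq_bigr => i _; rewrite mulNr.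
  + move=> i; apply: measurableT_comp => //; apply: measurable_funM => //.
  + by move=> i x; rewrite expR_ge0.
Qed.

(** * The Laplace transform of a squared Gaussian norm *)

Lemma integrable_bounded d (T : measurableType d) (R : realType)
    (P : probability T R) (f : T -> R) (M : R) :
  measurable_fun setT f -> (forall w, `|f w| <= M) -> P.-integrable setT (EFin \o f).
Proof.
move=> mf fM; apply: (@le_integrable _ _ _ _ _ measurableT _ (cst M%:E)).
- exact/measurable_EFinP.
- by move=> w _; rewrite /= lee_fin (le_trans (fM w)) // ler_norm.
- exact: finite_measure_integrable_cst.
Qed.

Lemma integral_gauss_cos (R : realType) (c : R) :
  (\int[lebesgue_measure]_x (gauss_fun x * cos (2 * c * x))%:E =
   (Num.sqrt pi * expR (- c ^+ 2))%:E)%E.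
Proof.
rewrite -Rintegral_gauss_cos /Rintegral fineK //.
apply: integrable_fin_num => //.
apply: (@integrable_bounded_mul _ _ _ (@lebesgue_measure R) gauss_fun _ 1).
- exact: integrableT_gauss.
- exact: (measurable_scale_trig R (2 * c)).2.
- by move=> x; rewrite ler_norml cos_geN1 cos_le1.
Qed.

Lemma integral_gauss_scaled (R : realType) (a : R) : 0 <= a ->
  (\int[lebesgue_measure]_x (gauss_fun x * expR (- a * x ^+ 2))%:E =
   (Num.sqrt pi * (Num.sqrt (1 + a))^-1)%:E)%E.
Proof.
move=> a0; have k0 : 0 < Num.sqrt (1 + a) by rewrite sqrtr_gt0; lra.
have := ge0_integral_scale R _ gauss_fun k0 measurable_gauss_fun gauss_fun_ge0.
rewrite integralT_gauss -EFinM mulrC => <-; apply: eq_integral => x _.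
rewrite /gauss_fun -expRD exprMn sqr_sqrtr; last by lra.
by congr (expR _)%:E; ring.
Qed.

(* Each Gaussian factor is averaged out through
   [exp (- s u^2) = pi^(-1/2) \int exp (- t^2) cos (2 sqrt s u t) dt]. *)
Lemma weighted_gaussian_laplace d (T : measurableType d) (R : realType)
    (P : probability T R) (N : nat) (W : T -> R) (U : 'I_N -> T -> R)
    (mu : 'I_N -> R) (A s : R) :
  measurable_fun setT W -> (forall w, 0 <= W w <= 1) ->
  (forall i, measurable_fun setT (U i)) -> (forall i, 0 <= mu i) -> 0 <= s ->
  (forall b : 'I_N -> R,
     (\int[P]_w (W w * cos (\sum_i b i * U i w))%:E =
      (A * expR (- (\sum_i mu i * b i ^+ 2) / 2))%:E)%E) ->
  (\int[P]_w (W w * expR (- s * \sum_i U i w ^+ 2))%:E =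
   (A * \prod_i (Num.sqrt (1 + 2 * s * mu i))^-1)%:E)%E.
Proof.
elim: N W U mu A => [|N IH] W U mu A mW W01 mU mu0 s0 H.
  have := H (fun _ => 0); rewrite !big_ord0 oppr0 mul0r expR0 => <-.
  by apply: eq_integral => w _; rewrite !big_ord0 mulr0 expR0 cos0.
set m0 := mu ord0; set U0 := U ord0.
(* The weight absorbs the factor of the coordinate being treated, so that the induction needs no
   independence of the coordinates. *)
pose W1 w := W w * expR (- s * U0 w ^+ 2).
have mU0 : measurable_fun setT U0 by exact: mU.
have mW1 : measurable_fun setT W1.
  apply: measurable_funM => //; apply: measurableT_comp => //.
  by apply: measurable_funM => //; exact: measurable_funX.
have W101 w : 0 <= W1 w <= 1.
  have /andP[h1 h2] := W01 w.
  rewrite /W1 mulr_ge0 ?expR_ge0 //= mulr_ile1 ?expR_ge0 // -expR0 ler_expR.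
  by rewrite mulNr oppr_le0 mulr_ge0 ?sqr_ge0.
transitivity (\int[P]_w (W1 w * expR (- s * \sum_i U (lift ord0 i) w ^+ 2))%:E)%E.
  apply: eq_integral => w _; rewrite big_ord_recl mulrDr expRD /W1 mulrA.
  by [].
rewrite (IH W1 (fun i => U (lift ord0 i)) (fun i => mu (lift ord0 i))
  (A * (Num.sqrt (1 + 2 * s * m0))^-1)) //; first by rewrite big_ord_recl mulrA.
move=> b.
pose V w := \sum_i b i * U (lift ord0 i) w.
have mV : measurable_fun setT V.
  by apply: measurable_sum => i; apply: measurable_funM.
have mcos : measurable_fun setT (@cos R).
  by apply: continuous_measurable_fun; exact: continuous_cos.
pose E := expR (- (\sum_i mu (lift ord0 i) * b i ^+ 2) / 2).
(* Integrating over t restores [W1] times the remaining cosine ([inner1]); integrating over [w] uses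
   the hypothesis on frequencies extended by 2 sqrt s t ([inner2]). Fubini equates the two. *)
pose f (z : T * measurableTypeR R) : \bar R :=
  (gauss_fun z.2 * (W z.1 * (cos (2 * (Num.sqrt s * U0 z.1) * z.2) * cos (V z.1))))%:E.
have cos1 (x : R) : `|cos x| <= 1 by rewrite ler_norml cos_geN1 cos_le1.
have inner1 w : (\int[lebesgue_measure]_t f (w, t) =
    (Num.sqrt pi * (W1 w * cos (V w)))%:E)%E.
  transitivity (\int[lebesgue_measure]_t ((W w * cos (V w))%:E *
      (gauss_fun t * cos (2 * (Num.sqrt s * U0 w) * t))%:E))%E.
    by apply: eq_integral => t _; rewrite -EFinM /f /=; congr (_%:E); ring.
  rewrite integralZl //; last first.
    apply: (@integrable_bounded_mul _ _ _ (@lebesgue_measure R) gauss_fun _ 1) => //.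
      exact: integrableT_gauss.
    exact: (measurable_scale_trig R _).2.
  rewrite integral_gauss_cos -EFinM exprMn sqr_sqrtr // /W1 mulNr.
  by congr (_%:E); ring.
have inner2 t : (\int[P]_w f (w, t) =
    (A * E * (gauss_fun t * expR (- (2 * s * m0) * t ^+ 2)))%:E)%E.
  (* The product of two cosines is half the sum of the cosines at two frequency vectors, which
     differ in the sign [e] of the entry for [U0]. *)
  pose bt (e : R) i := if unlift ord0 i is Some j then b j else e * (2 * Num.sqrt s * t).
  have btE e w : \sum_i bt e i * U i w = e * (2 * Num.sqrt s * t) * U0 w + V w.
    rewrite big_ord_recl /bt unlift_none; congr (_ + _).
    by apply: eq_bigr => i _; rewrite liftK.
  have HbE e : e ^+ 2 = 1 -> (\int[P]_w (W w * cos (\sum_i bt e i * U i w))%:E =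
      (A * (E * expR (- (2 * s * m0) * t ^+ 2)))%:E)%E.
    move=> e1; rewrite H; congr (_%:E); congr (_ * _).
    rewrite /E -expRD; congr expR; rewrite big_ord_recl /bt unlift_none.
    under eq_bigr do rewrite liftK.
    rewrite !exprMn sqr_sqrtr // e1 -/m0; by field.
  have iW e : P.-integrable setT (EFin \o (fun w => W w * cos (\sum_i bt e i * U i w))).
    apply: (@integrable_bounded _ _ _ _ _ 1) => [|w].
      apply: measurable_funM => //; apply: measurableT_comp => //.
      by apply: measurable_sum => i; apply: measurable_funM.
    have /andP[w0 w1] := W01 w.
    by rewrite normrM (ger0_norm w0) mulr_ile1.
  transitivity (\int[P]_w ((gauss_fun t / 2)%:E * ((W w * cos (\sum_i bt 1 i * U i w))%:E +
      (W w * cos (\sum_i bt (-1) i * U i w))%:E)))%E.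
    apply: eq_integral => w _; rewrite -EFinD -EFinM /f /=; congr (_%:E).
    rewrite !btE mulN1r mul1r mulNr !cosD cosN sinN.
    rewrite (_ : 2 * (Num.sqrt s * U0 w) * t = 2 * Num.sqrt s * t * U0 w); last by ring.
    by field.
  rewrite integralZl //; last by apply: integrableD => //; exact: iW.
  rewrite integralD //; [|exact: iW|exact: iW].
  rewrite !HbE ?sqrrN ?expr1n // -EFinD -EFinM; congr (_%:E); by field.
have fint : (P \x lebesgue_measure)%E.-integrable setT f.
  have m2 : measurable_fun setT (fun z : T * measurableTypeR R => z.2 : R).
    exact: measurable_snd.
  have mVz : measurable_fun setT (fun z : T * measurableTypeR R => V z.1).
    exact: (measurableT_comp mV).
  have mU0z : measurable_fun setT (fun z : T * measurableTypeR R => U0 z.1).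
    exact: (measurableT_comp mU0).
  have mWz : measurable_fun setT (fun z : T * measurableTypeR R => W z.1).
    exact: (measurableT_comp mW).
  have mf : measurable_fun setT f.
    apply/measurable_EFinP; apply: measurable_funM.
      by apply: measurableT_comp m2; exact: measurable_gauss_fun.
    apply: measurable_funM => //; apply: measurable_funM; last exact: measurableT_comp.
    apply: measurableT_comp => //; apply: measurable_funM => //.
    by apply: measurable_funM => //; apply: measurable_funM.
  apply/integrable12ltyP => //.
  apply: (@le_lt_trans _ _ (\int[P]_w (Num.sqrt pi)%:E)%E); last first.
    by rewrite integral_cst //= probability_setT mule1 ltry.
  apply: ge0_le_integral => //.
  - by move=> w _; apply: integral_ge0.
  - apply: (@measurable_fun_fubini_tonelli_F _ _ _ _ _ _ (fun z => `|f z|%E)) => //.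
    exact: measurableT_comp.
  - move=> w _; rewrite -integralT_gauss; apply: ge0_le_integral => //.
    + apply: measurableT_comp => //; apply: (measurableT_comp mf).
      exact: pair1_measurable.
    + by apply/measurable_EFinP; exact: measurable_gauss_fun.
    + move=> t _; rewrite /f /= lee_fin normrM (ger0_norm (gauss_fun_ge0 _)).
      rewrite ler_piMr ?gauss_fun_ge0 // !normrM; have /andP[w0 w1] := W01 w.
      by rewrite (ger0_norm w0) mulr_ile1 ?mulr_ge0 // mulr_ile1.
have := Fubini fint.
under eq_integral do rewrite inner1 EFinM.
under [X in _ = X -> _]eq_integral do rewrite inner2 EFinM.
rewrite integralZl //; last first.
  apply: (@integrable_bounded_mul _ _ _ (@lebesgue_measure R) gauss_fun _ 1) => //.
  - exact: integrableT_gauss.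
  - apply: measurableT_comp => //; apply: measurable_funM => //; exact: measurable_funX.
  - move=> x; rewrite ger0_norm ?expR_ge0 // -expR0 ler_expR mulNr oppr_le0.
    apply: mulr_ge0; last exact: sqr_ge0.
    by apply: mulr_ge0; [rewrite mulr_ge0|exact: mu0].
rewrite integralZl //; last first.
  apply: (@integrable_bounded _ _ _ _ _ 1) => [|w].
    by apply: measurable_funM => //; exact: measurableT_comp.
  by have /andP[w0 w1] := W101 w; rewrite normrM (ger0_norm w0) mulr_ile1.
rewrite integral_gauss_scaled; last by rewrite !mulr_ge0 //; exact: mu0.
move=> /(congr1 (fun z => ((Num.sqrt pi)^-1)%:E * z)%E).
have pi0 : Num.sqrt pi != 0 :> R by rewrite gt_eqF // sqrtr_gt0 pi_gt0.
rewrite muleA -EFinM mulVf // mul1e => ->; rewrite -!EFinM; congr (_%:E).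
have sm0 : 0 <= 2 * s * m0 by apply: mulr_ge0; [rewrite mulr_ge0|exact: mu0].
by rewrite /E; field; rewrite pi0 gt_eqF // sqrtr_gt0; lra.
Qed.

(** The rotation [O] preserves the norm and makes the quadratic form in the characteristic function
    diagonal. Each [mu 0 i] is nonnegative because exp (-mu_i/2) is the expectation of a cosine. *)
Lemma gaussian_sqnorm_laplace d (T : measurableType d) (R : realType)
    (Q : probability T R) (N : nat) (Z : T -> 'rV[R]_N) (S O : 'M[R]_N)
    (mu : 'rV[R]_N) (s : R) :
  (forall i, measurable_fun setT (fun w => Z w 0 i)) ->
  is_gaussian Q Z S -> O *m O^T = 1%:M -> S = O^T *m diag_mx mu *m O ->
  (forall i, 0 <= mu 0 i) /\
  (0 <= s -> (\int[Q]_w (expR (- s * \sum_i Z w 0 i ^+ 2))%:E =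
   (\prod_i (Num.sqrt (1 + 2 * s * mu 0 i))^-1)%:E)%E).
Proof.
move=> mZ gZ OO SE.
have quad (b : 'rV[R]_N) : ((b *m O) *m S *m (b *m O)^T) 0 0 = \sum_i mu 0 i * b 0 i ^+ 2.
  have -> : (b *m O) *m S *m (b *m O)^T = b *m diag_mx mu *m b^T.
    rewrite SE trmx_mul !mulmxA -(mulmxA b) OO mulmx1.
    by rewrite -!mulmxA (mulmxA O O^T) OO mul1mx.
  rewrite mxE; apply: eq_bigr => i _.
  by rewrite mul_mx_diag !mxE; ring.
pose U (i : 'I_N) (w : T) := \sum_k O i k * Z w 0 k.
have mU i : measurable_fun setT (U i).
  by apply: measurable_sum => k; apply: measurable_funM.
have dotE (b : 'rV[R]_N) w : \sum_k (b *m O) 0 k * Z w 0 k = \sum_i b 0 i * U i w.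
  under eq_bigr do rewrite mxE mulr_suml.
  rewrite exchange_big; apply: eq_bigr => i _; rewrite mulr_sumr.
  by apply: eq_bigr => k _; rewrite mulrA.
have mcos : measurable_fun setT (@cos R).
  by apply: continuous_measurable_fun; exact: continuous_cos.
have cosE (b : 'rV[R]_N) : (\int[Q]_w (cos (\sum_i b 0 i * U i w))%:E =
    (expR (- (\sum_i mu 0 i * b 0 i ^+ 2) / 2))%:E)%E.
  have [+ _] := gZ (b *m O); rewrite quad => <-; apply: eq_integral => w _.
  by rewrite dotE.
have mu0 i : 0 <= mu 0 i.
  have h := cosE (delta_mx 0 i).
  have : (\int[Q]_w (cos (\sum_j (delta_mx 0 i : 'rV[R]_N) 0 j * U j w))%:E <= 1)%E.
    apply: (@le_trans _ _ (\int[Q]_w 1)%E).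
      apply: le_integral => //.
      - apply: (@integrable_bounded _ _ _ _ _ 1) => [|w].
          apply: measurableT_comp => //.
          by apply: measurable_sum => j; apply: measurable_funM.
        by rewrite ler_norml cos_geN1 cos_le1.
      - exact: finite_measure_integrable_cst.
      - by move=> w _; rewrite lee_fin cos_le1.
    by rewrite integral_cst //= probability_setT mule1.
  rewrite h lee_fin -[leRHS]expR0 ler_expR (bigD1 i) //= big1 => [|j ji].
    by rewrite mxE !eqxx expr1n mulr1 addr0; lra.
  by rewrite mxE eqxx (negPf ji) expr0n mulr0.
split=> // s0.
have normE w : \sum_i Z w 0 i ^+ 2 = \sum_i U i w ^+ 2.
  have UE : Z w *m O^T = \row_i U i w.
    by apply/rowP => i; rewrite !mxE; apply: eq_bigr => k _; rewrite mxE mulrC.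
  transitivity ((Z w *m O^T *m (Z w *m O^T)^T) 0 0).
    rewrite trmx_mul trmxK -mulmxA (mulmxA O^T) (mulmx1C OO) mul1mx mxE.
    by apply: eq_bigr => i _; rewrite mxE -expr2.
  by rewrite UE mxE; apply: eq_bigr => i _; rewrite !mxE -expr2.
have := @weighted_gaussian_laplace _ _ _ Q N (cst 1) U (fun i => mu 0 i) 1 s.
rewrite mul1r => <- //.
- by apply: eq_integral => w _; rewrite normE mul1r.
- by move=> w; rewrite /= ler01 lexx.
- move=> b; have := cosE (\row_i b i).
  under eq_integral do [under eq_bigr do rewrite mxE].
  under [in X in _ = X -> _]eq_bigr do rewrite mxE.
  by rewrite mul1r => <-; apply: eq_integral => w _; rewrite mul1r.
Qed.

(** * Weierstrass approximation and uniqueness of Laplace transforms *)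

(** Compactness of [a, b] makes the tolerance uniform along the curve, while [w] may leave the
    curve. It is used with the identity for polynomial approximation, and with a line through 0 for
    convergence in law. *)
Lemma curve_uniform_continuity (R : realType) (V : normedModType R)
    (f : V -> R) (h : R -> V) (a b e : R) :
  continuous f -> continuous h -> 0 < e ->
  exists2 dlt : R, 0 < dlt &
    forall v w, a <= v <= b -> `|h v - w| < dlt -> `|f (h v) - f w| <= e.
Proof.
move=> cf ch e0.
have cK : compact `[a, b]%classic by exact: (@segment_compact R a b).
have := (@compact_near_coveringP _ `[a, b]%classic).1 cK.
move=> /(_ R (0^'+) (fun dlt v => forall w, `|h v - w| < dlt -> `|f (h v) - f w| <= e) _).
case.
  move=> v0 _.
  have /cvgrPdist_lt /(_ (e / 2)) := cf (h v0); rewrite divr_gt0 // => /(_ isT).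
  move=> /nbhs_ballP [eta /= eta0 Heta].
  have eta2 : 0 < eta / 2 by rewrite divr_gt0.
  have /cvgrPdist_lt /(_ _ eta2) hv := ch v0.
  exists ([set v | `|h v0 - h v| < eta / 2], [set x : R | 0 < x < eta / 2]) => /=.
    split; first exact: hv.
    by near=> x; apply/andP; split; near: x; [exact: nbhs_right_gt|exact: nbhs_right_lt].
  move=> [v x] /= [hvv /andP[x0 xe]] w hw.
  have h1 : `|f (h v0) - f (h v)| < e / 2.
    apply: Heta; rewrite -ball_normE /ball_ /=; lra.
  have h2 : `|f (h v0) - f w| < e / 2.
    apply: Heta; rewrite -ball_normE /ball_ /=; apply: (@le_lt_trans _ _ (`|h v0 - h v| + `|h v - w|)); last by lra.
    by rewrite -[h v0 - w](subrKA (h v)) ler_normD.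
  rewrite -[f (h v) - f w](subrKA (f (h v0))).
  by apply: (le_trans (ler_normD _ _)); rewrite distrC; lra.
move=> /= x x0 Hx; exists (x / 2); first by rewrite divr_gt0.
move=> v w vab hw; apply: (Hx (x / 2)) => //=; rewrite ?divr_gt0 //.
by rewrite sub0r normrN gtr0_norm ?divr_gt0 //; lra.
Unshelve. all: by end_near.
Qed.

(* [(bernstein n phi).[x]] is the expectation of [phi] under the binomial law of
   parameters [n] and [x], through the recursion on the first trial. *)
Fixpoint bernstein {R : realType} (n : nat) (phi : nat -> R) : {poly R} :=
  if n is n'.+1
  then 'X * bernstein n' (fun k => phi k.+1) + (1 - 'X) * bernstein n' phi
  else (phi 0%N)%:P.

Lemma bernsteinS (R : realType) n (phi : nat -> R) (x : R) :
  (bernstein n.+1 phi).[x] =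
  x * (bernstein n (fun k => phi k.+1)).[x] + (1 - x) * (bernstein n phi).[x].
Proof. by rewrite /= !hornerE. Qed.

Lemma bernstein_le (R : realType) n (phi psi : nat -> R) (x : R) :
  0 <= x <= 1 -> (forall k, phi k <= psi k) ->
  (bernstein n phi).[x] <= (bernstein n psi).[x].
Proof.
move=> /andP[x0 x1]; elim: n phi psi => [|n IH] phi psi h; first by rewrite /= !hornerC.
by rewrite !bernsteinS lerD // ler_wpM2l ?subr_ge0 // IH.
Qed.

(** The second moment of the binomial law about [a]. The centre is arbitrary because a success in
    the first trial shifts it to [a - 1]. *)
Lemma bernstein_quadratic (R : realType) n (x a b c : R) :
  (bernstein n (fun k => b + c * (k%:R - a) ^+ 2)).[x] =
  b + c * (n%:R * x * (1 - x) + (n%:R * x - a) ^+ 2).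
Proof.
elim: n a => [|n IH] a; first by rewrite /= hornerC; ring.
rewrite bernsteinS (_ : (fun k => _) = (fun k => b + c * (k%:R - (a - 1)) ^+ 2)).
  by rewrite !IH -natr1; ring.
by apply/funext => k; rewrite -natr1; ring.
Qed.

(** Bernstein's argument: at nodes farther than [dl] from x the oscillation 2B is at most 2B (x -
    k/n)^2 / dl^2, so a quadratic bound holds at every node and the binomial variance controls its
    mean. *)
Lemma weierstrass01 (R : realType) (g : R -> R) (e : R) :
  continuous g -> 0 < e ->
  exists p : {poly R}, forall x, 0 <= x <= 1 -> `|g x - p.[x]| <= e.
Proof.
move=> cg e0.
have e20 : 0 < e / 2 by rewrite divr_gt0.
have [dl dl0 Hd] := curve_uniform_continuity R R g id 0 1 _ cg (fun x => cvg_id) e20.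
have [B [B0 HB]] : exists B : R, 0 < B /\ forall x, 0 <= x <= 1 -> `|g x| <= B.
  have cn : {within `[0, 1], continuous (fun x => `|g x|)}.
    by apply: continuous_subspaceT => x; apply: continuous_comp; [exact: cg|exact: norm_continuous].
  have [c _ Hc] := EVT_max ler01 cn.
  exists (`|g c| + 1); split; first by rewrite ltr_wpDl.
  by move=> x x01; rewrite (le_trans (Hc x _)) ?lerDl // in_itv.
(* By x (1 - x) <= 1/4 the variance term is at most B / (2 dl^2 n), hence at most e/2 once n >= B /
   (dl^2 e). *)
pose n := (Num.bound (B / (dl ^+ 2 * e))).+1.
have nE : B / (dl ^+ 2 * e) < n%:R.
  apply: lt_trans (archi_boundP _) _; last by rewrite ltr_nat.
  by rewrite divr_ge0 ?mulr_ge0 ?sqr_ge0 // ltW.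
have n0 : 0 < n%:R :> R by rewrite ltr0n.
have key x (k : nat) : 0 <= x <= 1 -> (k <= n)%N ->
  `|g x - g (k%:R / n%:R)| <= e / 2 + 2 * B / (dl ^+ 2 * n%:R ^+ 2) * (k%:R - n%:R * x) ^+ 2.
  move=> x01 kn.
  have q0 : 0 <= 2 * B / (dl ^+ 2 * n%:R ^+ 2) * (k%:R - n%:R * x) ^+ 2.
    by rewrite mulr_ge0 ?sqr_ge0 // divr_ge0 ?mulr_ge0 ?sqr_ge0 // ltW.
  have [h|h] := ltP `|x - k%:R / n%:R| dl; first by have := Hd _ _ x01 h; lra.
  have k01 : 0 <= (k%:R / n%:R : R) <= 1.
    by rewrite divr_ge0 ?ler0n //= ler_pdivrMr // mul1r ler_nat.
  have h2B : `|g x - g (k%:R / n%:R)| <= 2 * B.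
    by rewrite (le_trans (ler_normB _ _)) //; have := HB _ x01; have := HB _ k01; lra.
  have h1 : dl ^+ 2 <= (x - k%:R / n%:R) ^+ 2.
    by rewrite -[leRHS]real_normK ?num_real // lerXn2r ?nnegrE ?(ltW dl0).
  have -> : 2 * B / (dl ^+ 2 * n%:R ^+ 2) * (k%:R - n%:R * x) ^+ 2 =
      2 * B * ((x - k%:R / n%:R) ^+ 2 / dl ^+ 2).
    by field; rewrite !gt_eqF.
  have h3 : 1 <= (x - k%:R / n%:R) ^+ 2 / dl ^+ 2.
    by rewrite ler_pdivlMr ?exprn_gt0 // mul1r.
  have h4 : 2 * B <= 2 * B * ((x - k%:R / n%:R) ^+ 2 / dl ^+ 2).
    by rewrite ler_peMr // mulr_ge0 // ltW.
  by lra.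
(* Past [n] the value of [phi] is irrelevant; [minn] keeps the nodes in [0, 1]. *)
pose phi (k : nat) : R := g ((minn k n)%:R / n%:R).
exists (bernstein n phi) => x x01.
pose c := 2 * B / (dl ^+ 2 * n%:R ^+ 2).
have c0 : 0 <= c by rewrite divr_ge0 ?mulr_ge0 ?sqr_ge0 // ltW.
have phik k : `|g x - phi k| <= e / 2 + c * (k%:R - n%:R * x) ^+ 2.
  apply: (le_trans (key x _ x01 (geq_minr k n))).
  rewrite lerD2l ler_wpM2l //.
  have /andP[x0 x1] := x01.
  case: (leqP k n) => [_|kn] //.
  (* Beyond [n] the node stays at 1 while the quadratic bound keeps growing, because n x <= n <
     k. *)
  have kn' : n%:R < k%:R :> R by rewrite ltr_nat.
  have nx : n%:R * x <= n%:R by rewrite ler_piMr // ltW.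
  rewrite lerXn2r ?nnegrE; lra.
have q1 := bernstein_quadratic R n x (n%:R * x) (g x + e / 2) c.
have q2 := bernstein_quadratic R n x (n%:R * x) (g x - e / 2) (- c).
have tot : c * (n%:R * x * (1 - x)) <= e / 2.
  have /andP[x0 x1] := x01.
  have xx : x * (1 - x) <= 4^-1 by have := sqr_ge0 (x - 2^-1); lra.
  apply: (@le_trans _ _ (c * (n%:R * 4^-1))).
    by rewrite ler_wpM2l // -mulrA ler_wpM2l // ltW.
  have -> : c * (n%:R * 4^-1) = B / (dl ^+ 2 * e) / n%:R * (e / 2).
    by rewrite /c; field; rewrite !gt_eqF.
  by rewrite ler_piMl ?(ltW e20) // ler_pdivrMr // mul1r ltW.
have up := bernstein_le R n phi (fun k => (g x + e / 2) + c * (k%:R - n%:R * x) ^+ 2) x x01.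
have lo := bernstein_le R n (fun k => (g x - e / 2) + - c * (k%:R - n%:R * x) ^+ 2) phi x x01.
rewrite q1 in up; rewrite q2 in lo.
have up' := up (fun k => ltac:(have := phik k; rewrite ler_norml; lra)).
have lo' := lo (fun k => ltac:(have := phik k; rewrite ler_norml; lra)).
by rewrite subrr expr0n addr0 in up' lo'; rewrite ler_norml; lra.
Qed.

Lemma dist_Rintegral_le d (T : measurableType d) (R : realType)
    (P : probability T R) (f g : T -> R) (e : R) :
  P.-integrable setT (EFin \o f) -> P.-integrable setT (EFin \o g) ->
  (forall w, `|f w - g w| <= e) ->
  `|\int[P]_w f w - \int[P]_w g w| <= e.
Proof.
move=> fi gi fge; rewrite -RintegralB //.
have fgi : P.-integrable setT (EFin \o (fun w => f w - g w)) by exact: (integrableB measurableT fi gi).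
apply: (le_trans (le_normr_Rintegral measurableT fgi)).
apply: (@le_trans _ _ (\int[P]_w cst e w)).
  apply: le_Rintegral => //; first exact: (integrable_norm fgi).
  exact: finite_measure_integrable_cst.
by rewrite /cst Rintegral_cst // [X in fine X](_ : _ = 1%E) ?mulr1 //; exact: probability_setT.
Qed.

Lemma eq_of_dist_le (R : realType) (a b : R) :
  (forall e, 0 < e -> `|a - b| <= 2 * e) -> a = b.
Proof.
move=> h; apply/eqP; rewrite -subr_eq0 -normr_le0; apply/ler_addgt0Pr => e e0.
rewrite add0r; have := h (e / 2); rewrite divr_gt0 // => /(_ isT); lra.
Qed.

Lemma expR_opp_mul01 (R : realType) (s x : R) :
  0 <= s -> 0 <= x -> 0 <= expR (- s * x) <= 1.
Proof.
by move=> s0 x0; rewrite expR_ge0 /= -expR0 ler_expR mulNr oppr_le0 mulr_ge0.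
Qed.

(** Serves twice: to remove the damping factor in the uniqueness proof and, with f = 1, to obtain
    tightness from Laplace transforms. *)
Lemma cvg_damped_integral d (T : measurableType d) (R : realType)
    (P : probability T R) (Z : T -> R) (f : R -> R) (M : R) :
  measurable_fun setT Z -> (forall w, 0 <= Z w) ->
  continuous f -> (forall x, `|f x| <= M) ->
  (\int[P]_w (expR (- n.+1%:R^-1 * Z w) * f (Z w))%:E)%E @[n --> \oo] -->
  (\int[P]_w (f (Z w))%:E)%E.
Proof.
move=> mZ Z0 cf fM.
have mf : measurable_fun setT f by exact: continuous_measurable_fun.
have [//|||||//] := @dominated_convergence _ _ _ P _ measurableT
  (fun n w => (expR (- n.+1%:R^-1 * Z w) * f (Z w))%:E) (fun w => (f (Z w))%:E) (cst M%:E).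
- move=> n; apply/measurable_EFinP; apply: measurable_funM; last exact: measurableT_comp.
  by apply: measurableT_comp => //; exact: measurable_funM.
- by apply/measurable_EFinP; exact: measurableT_comp.
- apply: aeW => w _; apply: cvg_EFin; first exact: nearW.
  rewrite -[X in _ --> X]mul1r; apply: cvgM; last exact: cvg_cst.
  rewrite -[X in _ --> X]expR0.
  apply: (cvg_comp (fun n : nat => - n.+1%:R^-1 * Z w) expR); last exact: continuous_expR.
  have c0 : - n.+1%:R^-1 * Z w @[n --> \oo] --> (0 : R).
    rewrite -[X in _ --> X](mul0r (Z w)); apply: cvgMl.
    by rewrite -[X in _ --> X]oppr0; apply: cvgN; exact: cvg_harmonic.
  exact: c0.
- exact: finite_measure_integrable_cst.
- apply: aeW => w n _; rewrite /= lee_fin normrM.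
  have /andP[h0 h1] : 0 <= expR (- n.+1%:R^-1 * Z w) <= 1 by apply: expR_opp_mul01; rewrite ?invr_ge0.
  by rewrite (ger0_norm h0) (le_trans _ (fM (Z w))) // ler_piMl.
Qed.

Section laplace_unique.
Context (R : realType) d1 (T1 : measurableType d1) (P1 : probability T1 R)
  d2 (T2 : measurableType d2) (P2 : probability T2 R).
Context (X : T1 -> R) (Y : T2 -> R).
Context (mX : measurable_fun setT X) (mY : measurable_fun setT Y)
  (X0 : forall w, 0 <= X w) (Y0 : forall w, 0 <= Y w).
Context (laplaceXY : forall s, 0 <= s ->
  (\int[P1]_w (expR (- s * X w))%:E = \int[P2]_w (expR (- s * Y w))%:E)%E).

Let laplaceR s : 0 <= s ->
  \int[P1]_w expR (- s * X w) = \int[P2]_w expR (- s * Y w).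
Proof. by move=> s0; rewrite /Rintegral laplaceXY. Qed.

Let integrable_unit d (T : measurableType d) (P : probability T R) (Z : T -> R)
    (h : R -> R) (s : R) : measurable_fun setT Z -> (forall w, 0 <= Z w) -> 0 <= s ->
  continuous h -> P.-integrable setT (EFin \o (fun w => h (expR (- s * Z w)))).
Proof.
move=> mZ Z0 s0 ch.
have cn : {within `[0, 1], continuous (fun x => `|h x|)}.
  by apply: continuous_subspaceT => x; apply: continuous_comp; [exact: ch|exact: norm_continuous].
have [c _ Hc] := EVT_max ler01 cn.
apply: (@integrable_bounded _ _ _ _ _ `|h c|) => [|w].
  apply: measurableT_comp; first exact: continuous_measurable_fun.
  by apply: measurableT_comp => //; exact: measurable_funM.
by apply: Hc; rewrite in_itv /= expR_opp_mul01.
Qed.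

Let continuous_Xnp (k : nat) (p : {poly R}) : continuous (fun x : R => x ^+ k * p.[x]).
Proof.
rewrite (_ : (fun x => _) = (fun x => ('X^k * p).[x])); first exact: continuous_horner.
by apply/funext => x; rewrite !hornerE.
Qed.

(** Powers of exp (-s X) are again exponentials, so the Laplace transform fixes all moments of exp
    (-s X). The exponent [k] is carried along so that the induction passes through multiplication by
    the indeterminate. *)
Let poly_eq (p : {poly R}) (k : nat) (s : R) : 0 <= s ->
  \int[P1]_w (expR (- s * X w) ^+ k * p.[expR (- s * X w)]) =
  \int[P2]_w (expR (- s * Y w) ^+ k * p.[expR (- s * Y w)]).
Proof.
move=> s0; elim/poly_ind: p k => [|p c IH] k.
  by under eq_Rintegral do rewrite horner0 mulr0;
    under [RHS]eq_Rintegral do rewrite horner0 mulr0;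
    rewrite !Rintegral_cst // !mul0r.
pose h1 (x : R) := x ^+ k.+1 * p.[x]; pose h2 (x : R) := c * x ^+ k.
have split d (T : measurableType d) (P : probability T R) (Z : T -> R) :
    measurable_fun setT Z -> (forall w, 0 <= Z w) ->
  \int[P]_w (expR (- s * Z w) ^+ k * (p * 'X + c%:P).[expR (- s * Z w)]) =
  \int[P]_w (expR (- s * Z w) ^+ k.+1 * p.[expR (- s * Z w)]) +
  c * \int[P]_w expR (- (k%:R * s) * Z w).
  move=> mZ Z0.
  have i1 := integrable_unit _ _ P Z _ s mZ Z0 s0 (continuous_Xnp k.+1 p).
  have i2 := integrable_unit _ _ P Z _ (k%:R * s) mZ Z0 (mulr_ge0 (ler0n _ _) s0) (fun x => cvg_id).
  rewrite -RintegralZl // -RintegralD //; last exact: (integrableZl measurableT _ i2).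
  apply: eq_Rintegral => w _; rewrite !hornerE exprS.
  rewrite (_ : - (k%:R * s) * Z w = k%:R * (- s * Z w)); last by ring.
  by rewrite expRM_natl; ring.
by rewrite !split // IH laplaceR // mulr_ge0.
Qed.

Let continuous_eq (g : R -> R) (s : R) : 0 <= s -> continuous g ->
  \int[P1]_w g (expR (- s * X w)) = \int[P2]_w g (expR (- s * Y w)).
Proof.
move=> s0 cg; apply: eq_of_dist_le => e e0.
have [p Hp] := weierstrass01 R g e cg e0.
have cp : continuous (fun x => p.[x]) by exact: continuous_horner.
have h1 := dist_Rintegral_le _ _ _ P1 _ _ e (integrable_unit _ _ P1 X _ s mX X0 s0 cg)
  (integrable_unit _ _ P1 X _ s mX X0 s0 cp) (fun w => Hp _ (expR_opp_mul01 R _ _ s0 (X0 w))).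
have h2 := dist_Rintegral_le _ _ _ P2 _ _ e (integrable_unit _ _ P2 Y _ s mY Y0 s0 cg)
  (integrable_unit _ _ P2 Y _ s mY Y0 s0 cp) (fun w => Hp _ (expR_opp_mul01 R _ _ s0 (Y0 w))).
have := poly_eq p 0 s s0.
under eq_Rintegral do rewrite expr0 mul1r.
under [in X in _ = X -> _]eq_Rintegral do rewrite expr0 mul1r.
move: h1 h2; move: (\int[P1]_w g _) (\int[P1]_w p.[_]) (\int[P2]_w g _) (\int[P2]_w p.[_]).
move=> a b c d' /=; rewrite !ler_norml; lra.
Qed.

(* [u |-> u * f (- ln u / s)] vanishes at 0, so that it is continuous on [0, 1]; the
   damping factor [exp (- s X)] that it leaves is removed by letting [s] tend to 0. *)
Lemma laplace_unique (f : R -> R) (M : R) : continuous f -> (forall x, `|f x| <= M) ->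
  (\int[P1]_w (f (X w))%:E = \int[P2]_w (f (Y w))%:E)%E.
Proof.
move=> cf fM.
have damp s : 0 < s ->
    \int[P1]_w (expR (- s * X w) * f (X w)) = \int[P2]_w (expR (- s * Y w) * f (Y w)).
  (* The positive part replaces [u], so that [g] vanishes for u <= 0 and is continuous on the whole
     line; boundedness of [f] settles continuity at 0. *)
  move=> s0; pose g (u : R) := (u + `|u|) / 2 * f (- ln u / s).
  have gE (x : R) : g (expR (- s * x)) = expR (- s * x) * f x.
    rewrite /g expRK; congr (_ * f _); last by field; rewrite gt_eqF.
    by rewrite ger0_norm ?expR_ge0 //; field.
  have cg : continuous g.
    have ch : continuous (fun u : R => (u + `|u|) / 2).
      by move=> u; apply: cvgMl; apply: cvgD; [exact: cvg_id|exact: norm_continuous].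
    move=> u; have [u0|u0] := ltP 0 u.
      apply: cvgM; first exact: ch.
      apply: (cvg_comp (fun x => - ln x / s) f); last exact: cf.
      by apply: cvgMl; apply: cvgN; exact: continuous_ln.
    have h0 : (u + `|u|) / 2 = 0 by rewrite ler0_norm //; field.
    rewrite /continuous_at {2}/g h0 mul0r; apply: norm_cvg0.
    have hM : (v + `|v|) / 2 * M @[v --> u] --> (0 : R).
      by rewrite -(mul0r M) -h0; apply: cvgMl; exact: ch.
    apply: (@squeeze_cvgr _ _ _ _ (cst 0) _ _ _ _ _ hM); last exact: cvg_cst.
    apply: nearW => v; rewrite normr_ge0 /= normrM ger0_norm ?ler_wpM2l //.
      by have := ler_norm (- v); rewrite normrN; lra.
    by have := ler_norm (- v); rewrite normrN; lra.
  have := continuous_eq g s (ltW s0) cg.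
  under eq_Rintegral do rewrite gE.
  by under [in X in _ = X -> _]eq_Rintegral do rewrite gE.
have mf : measurable_fun setT f by exact: continuous_measurable_fun.
have intf n d (T : measurableType d) (P : probability T R) (Z : T -> R) :
    measurable_fun setT Z -> (forall w, 0 <= Z w) ->
  (\int[P]_w (expR (- n.+1%:R^-1 * Z w) * f (Z w))%:E)%E =
  (\int[P]_w (expR (- n.+1%:R^-1 * Z w) * f (Z w)))%:E.
  move=> mZ Z0; rewrite /Rintegral fineK // integrable_fin_num //.
  apply: (@integrable_bounded _ _ _ _ _ M) => [|w].
    apply: measurable_funM; last exact: measurableT_comp.
    by apply: measurableT_comp => //; exact: measurable_funM.
  have /andP[h0 h1] : 0 <= expR (- n.+1%:R^-1 * Z w) <= 1 by apply: expR_opp_mul01; rewrite ?invr_ge0.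
  by rewrite normrM (ger0_norm h0) (le_trans _ (fM (Z w))) // ler_piMl.
have := cvg_damped_integral _ _ _ P1 X f M mX X0 cf fM; under eq_fun do rewrite intf // damp ?invr_gt0 //.
move=> h1; have := cvg_damped_integral _ _ _ P2 Y f M mY Y0 cf fM; under eq_fun do rewrite intf //.
exact: cvg_unique h1.
Qed.

End laplace_unique.

(** * Second-order expansion of the entropy at the uniform vector *)

(** The lower bound is the upper one applied to 1 / (1 + c). *)
Lemma ln_bounds (R : realType) (c : R) : -1 < c -> c / (1 + c) <= ln (1 + c) <= c.
Proof.
move=> c1; have c0 : 0 < 1 + c by lra.
rewrite le_ln1Dx // andbT.
have i0 : 0 < (1 + c)^-1 by rewrite invr_gt0.
have h : -1 < (1 + c)^-1 - 1 by rewrite ltrBrDl subrr.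
have := le_ln1Dx h; rewrite addrC subrK lnV ?posrE // => h2.
have -> : c / (1 + c) = 1 - (1 + c)^-1 by field; rewrite gt_eqF.
by move: h2; move: (ln _) ((1 + c)^-1) => a b; clear; lra.
Qed.

(** The range includes x = -1, where a pattern has frequency 0. For |x| >= 1/2 the bounds x and x +
    x^2 suffice; for smaller |x| the mean value theorem applies, the derivative ln (1 + y) - y being
    at most 2 x^2 in absolute value. *)
Lemma xlnx_expansion (R : realType) (x : R) : -1 <= x ->
  `|(1 + x) * ln (1 + x) - (x + x ^+ 2 / 2)| <= 2 * `|x| ^+ 3.
Proof.
rewrite le_eqVlt => /predU1P[<-|x1].
  rewrite subrr mul0r normrN1 expr1n sqrrN expr1n ler_norml; apply/andP; split; lra.
have x2 : `|x| ^+ 2 = x ^+ 2 by rewrite real_normK ?num_real.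
have x0 : 0 < 1 + x by lra.
have /andP[l1 l2] := ln_bounds R x x1.
have [hx|hx] := leP 2^-1 `|x|.
  have h1 : x <= (1 + x) * ln (1 + x) by rewrite mulrC -ler_pdivrMr.
  have h2 : (1 + x) * ln (1 + x) <= x + x ^+ 2.
    by apply: (@le_trans _ _ ((1 + x) * x)); [rewrite ler_wpM2l // ltW|rewrite mulrDl mul1r].
  have h3 : x ^+ 2 / 2 <= 2 * `|x| ^+ 3.
    rewrite [in leRHS]exprS x2; move: (ler_wpM2r (sqr_ge0 x) hx) (sqr_ge0 x).
    by move: (`|x| * x ^+ 2) (x ^+ 2); clear => a b; lra.
  rewrite ler_norml; move: h1 h2 h3.
  by move: ((1 + x) * ln (1 + x)) (x ^+ 2) (`|x| ^+ 3); clear => a b c; lra.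
clear l1 l2.
pose g (y : R) := (1 + y) * ln (1 + y) - (y + y ^+ 2 / 2).
have dg (y : R) : -1 < y -> is_derive y 1 g (ln (1 + y) - y).
  move=> y1; have y0 : 0 < 1 + y by lra.
  have h1 : is_derive y 1 (fun y : R => 1 + y) 1.
    by have := is_deriveD (is_derive_cst (1 : R) y 1) (is_derive_id y 1); rewrite add0r.
  have h2 := @is_derive1_comp _ (@ln R) (fun y : R => 1 + y) y _ _ (is_derive1_ln y0) h1.
  have h3 := @is_deriveM _ _ _ _ y 1 _ _ h1 h2.
  have h4 : is_derive y 1 (fun y : R => y + y ^+ 2 / 2) (1 + y).
    by apply: is_derive_eq; rewrite /GRing.scale /= mulr1; field.
  have h5 := is_deriveB h3 h4.
  by apply: is_derive_eq; rewrite /GRing.scale /=; field; rewrite gt_eqF.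
have g0 : g 0 = 0 by rewrite /g addr0 ln1 expr0n mul0r; ring.
have cg (a b : R) : -1 < a -> {within `[a, b], continuous g}.
  move=> a1; apply: derivable_within_continuous => y; rewrite in_itv /= => /andP[ay _].
  by have := dg y (lt_le_trans a1 ay) => h; exact: ex_derive.
have bnd (c : R) : `|c| <= `|x| -> `|ln (1 + c) - c| <= 2 * x ^+ 2.
  move=> cx; have c1 : -1 < c by have := ler_norm (- c); rewrite normrN; lra.
  have c2 : 2^-1 < 1 + c by have := ler_norm (- c); rewrite normrN; lra.
  have /andP[h1 h2] := ln_bounds R c c1.
  have h3 : c ^+ 2 <= x ^+ 2 by rewrite -x2 -[leLHS]real_normK ?num_real // lerXn2r ?nnegrE.
  have h4 : c - 2 * c ^+ 2 <= c / (1 + c).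
    rewrite ler_pdivlMr; last by clear h1; lra.
    have h5 : 0 <= c ^+ 2 * (1 + 2 * c).
      by rewrite mulr_ge0 ?sqr_ge0 //; clear h1; lra.
    by rewrite -subr_ge0 [leRHS](_ : _ = c ^+ 2 * (1 + 2 * c)) //; ring.
  have h6 := sqr_ge0 c; rewrite ler_norml; move: h1 h2 h3 h4 h6.
  by move: (c / (1 + c)) (ln (1 + c)) (c ^+ 2) (x ^+ 2); clear => a b u v; lra.
rewrite -/(g x); suff [c cx ->] : exists2 c, `|c| <= `|x| & g x = (ln (1 + c) - c) * x.
  by rewrite normrM exprSr mulrA ler_wpM2r // x2 bnd.
have [x0'|x0'|->] := ltgtP x 0; last by exists 0; rewrite ?normr0 // g0 mulr0.
- have [] := MVT x0' _ (cg x 0 x1) (df := fun y => ln (1 + y) - y).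
    by move=> y; rewrite in_itv /= => /andP[xy _]; apply: dg; lra.
  move=> c; rewrite in_itv /= => /andP[xc c0]; rewrite g0 => h; exists c; last by lra.
  by rewrite !ltr0_norm //; lra.
- have [] := MVT x0' _ (cg 0 x _) (df := fun y => ln (1 + y) - y).
  + by move=> y; rewrite in_itv /= => /andP[xy _]; apply: dg; lra.
  + by lra.
  move=> c; rewrite in_itv /= => /andP[xc c0]; rewrite g0 => h; exists c; last by lra.
  by rewrite !gtr0_norm //; lra.
Qed.

(** In the relative deviations x_k = N p_k - 1 the linear term sums to 0. Returning to p_k turns
    N^(-1) 2 |x_k|^3 into 2 N^2 |p_k - 1/N|^3. *)
Lemma entropy_expansion (R : realType) (N : nat) (p : 'I_N -> R) : (0 < N)%N ->
  (forall k, 0 <= p k) -> \sum_k p k = 1 ->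
  `|shannonH p - ln N%:R + N%:R / 2 * \sum_k (p k - N%:R^-1) ^+ 2| <=
  2 * N%:R ^+ 2 * \sum_k `|p k - N%:R^-1| ^+ 3.
Proof.
move=> N0 p0 p1; have n0 : 0 < N%:R :> R by rewrite ltr0n.
have [x xD] : exists x : 'I_N -> R, forall k, x k = N%:R * p k - 1 by eexists.
have x1 k : -1 <= x k by have := mulr_ge0 (ltW n0) (p0 k); rewrite xD; lra.
have xE k : p k - N%:R^-1 = N%:R^-1 * x k by rewrite xD; field; rewrite gt_eqF.
have HE : shannonH p = ln N%:R - \sum_k N%:R^-1 * ((1 + x k) * ln (1 + x k)).
  have lE : ln N%:R = \sum_k ln N%:R * p k by rewrite -mulr_sumr p1 mulr1.
  rewrite /shannonH [X in X - _]lE -sumrB -sumrN; apply: eq_bigr => k _.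
  have e1 : 1 + x k = N%:R * p k by rewrite xD; ring.
  rewrite e1.
  have [->|pk] := eqVneq (p k) 0; first by rewrite !mulr0 mul0r !mulr0 subrr oppr0.
  have pk0 : 0 < p k by rewrite lt_neqAle eq_sym pk p0.
  by rewrite lnM ?posrE //; field; rewrite gt_eqF.
have sx : \sum_k x k = 0.
  under eq_bigr do rewrite xD.
  by rewrite sumrB -mulr_sumr p1 sumr_const card_ord mulr1 -mulr_natl mulr1 subrr.
have -> : shannonH p - ln N%:R + N%:R / 2 * \sum_k (p k - N%:R^-1) ^+ 2 =
    - \sum_k N%:R^-1 * ((1 + x k) * ln (1 + x k) - (x k + x k ^+ 2 / 2)).
  rewrite HE -!mulr_sumr sumrB big_split /= sx -mulr_suml.
  have -> : \sum_k (p k - N%:R^-1) ^+ 2 = N%:R^-1 ^+ 2 * \sum_k x k ^+ 2.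
    by rewrite mulr_sumr; apply: eq_bigr => k _; rewrite xE exprMn.
  by field; rewrite gt_eqF.
rewrite normrN (le_trans (ler_norm_sum _ _ _)) // mulr_sumr ler_sum // => k _.
rewrite xE !normrM gtr0_norm ?invr_gt0 // exprMn.
apply: (@le_trans _ _ (N%:R^-1 * (2 * `|x k| ^+ 3))).
  by rewrite ler_wpM2l ?invr_ge0 ?(ltW n0) // xlnx_expansion.
by rewrite le_eqVlt; apply/orP; left; apply/eqP; field; rewrite gt_eqF.
Qed.

(** * Convergence in law from an approximation on bounded sets *)

Lemma EintE d (T : measurableType d) (R : realType) (P : probability T R)
    (h : T -> R) (M : R) : measurable_fun setT h -> (forall w, `|h w| <= M) ->
  Eint P h = (\int[P]_w h w)%:E.
Proof.
move=> mh hM; rewrite /Eint /Rintegral fineK // integrable_fin_num //.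
exact: (@integrable_bounded _ _ _ _ _ M).
Qed.

Lemma measurable_expR_normr d (T : measurableType d) (R : realType) (W : T -> R) (s : R) :
  measurable_fun setT W -> measurable_fun setT (fun w => expR (- s * `|W w|)).
Proof.
move=> mW; apply: measurableT_comp => //; apply: measurable_funM => //.
exact: (measurableT_comp (@normr_measurable R setT) mW).
Qed.

(** A Slutsky argument in which [F n] is controlled only where [V n] is bounded. The complement is
    made negligible by Laplace transforms: [1 - exp (- s V)] is at least 1/2 where s V > 1. *)
Lemma cvg_distr_uniform_approx d (T : measurableType d) (R : realType)
    (P : probability T R) d' (T' : measurableType d') (Q : probability T' R)
    (k : nat) (F : nat -> T -> 'rV[R]_k) (V : nat -> T -> R) (V' : T' -> R)
    (c : 'rV[R]_k) :
  (forall n f, continuous f -> measurable_fun setT (fun w => f (F n w) : R)) ->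
  (forall n, measurable_fun setT (V n)) -> (forall n w, 0 <= V n w) ->
  measurable_fun setT V' -> (forall w, 0 <= V' w) ->
  (forall M dlt : R, 0 < dlt -> \forall n \near \oo, forall w,
     V n w <= M -> `|V n w *: c - F n w| < dlt) ->
  (forall g : R -> R, continuous g -> (exists M : R, forall x, `|g x| <= M) ->
     (fun n => Eint P (fun w => g (V n w))) @ \oo --> Eint Q (fun w => g (V' w))) ->
  cvg_distr P F Q (fun w => V' w *: c).
Proof.
move=> mF mV V0 mV' V'0 FV cV f cf [B fB].
have ch : continuous (fun v : R => v *: c).
  by move=> v; apply: cvgZr_tmp; exact: cvg_id.
have EV := cV (fun v => f (v *: c)) (fun v => continuous_comp (ch v) (cf _)) (ex_intro _ B (fun x => fB _)).
have mfV n : measurable_fun setT (fun w => f (V n w *: c)).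
  apply: (@measurableT_comp _ _ _ _ _ _ (fun v : R => f (v *: c))) => //.
  by apply: continuous_measurable_fun => v; apply: continuous_comp; [exact: ch|exact: cf].
have mfF n := mF n f cf.
suff h : \int[P]_w f (F n w) - \int[P]_w f (V n w *: c) @[n --> \oo] --> (0 : R).
  have mfV' : measurable_fun setT (fun w => f (V' w *: c)).
    apply: (@measurableT_comp _ _ _ _ _ _ (fun v : R => f (v *: c))) => //.
    by apply: continuous_measurable_fun => v; apply: continuous_comp; [exact: ch|exact: cf].
  rewrite (EintE _ _ _ Q _ B) // in EV *.
  have EV' : \int[P]_w f (V n w *: c) @[n --> \oo] --> \int[Q]_w f (V' w *: c).
    by apply/fine_cvg; exact: EV.
  under eq_fun do rewrite (EintE _ _ _ P _ B) //.
  apply: cvg_EFin; first exact: nearW.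
  have := cvgD h EV'; rewrite add0r => h2.
  rewrite (_ : fine \o _ = (fun n => \int[P]_w f (F n w) - \int[P]_w f (V n w *: c)) +
    (fun n => \int[P]_w f (V n w *: c))); first exact: h2.
  by apply/funext => n; rewrite /= fctE subrK.
(* The absolute value makes the exponential bounded on the whole line, hence an admissible test
   function. *)
have expc (s : R) : continuous (fun v : R => expR (- s * `|v|)).
  move=> v; apply: (cvg_comp (fun v : R => - s * `|v|) expR); last exact: continuous_expR.
  by apply: cvgMr; exact: norm_continuous.
have exp01 (s v : R) : 0 <= s -> 0 <= expR (- s * `|v|) <= 1.
  by move=> s0; exact: expR_opp_mul01.
have exp1 (s v : R) : 0 <= s -> `|expR (- s * `|v|)| <= 1.
  by move=> s0; have /andP[h1 h2] := exp01 s v s0; rewrite ger0_norm.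
have B0 : 0 <= B by apply: le_trans (fB 0).
apply/cvgrPdist_le => e e0.
(* Chosen so that (4B + 4) eta = e/2, with a denominator that stays positive when B = 0. *)
pose eta := e / (8 * B + 8).
have eta0 : 0 < eta by rewrite divr_gt0 //; lra.
(* Tightness of the limit: some rate s = 1/(m + 1) brings the transform of [V'] within [eta] of 1.
   Convergence in law passes the bound on to [V n] for large n. *)
have [m mE] : exists m : nat, 1 - eta < \int[Q]_w expR (- m.+1%:R^-1 * `|V' w|).
  have mN := measurableT_comp (@normr_measurable R setT) mV'.
  have c1 : continuous (cst 1 : R -> R) by move=> x; exact: cvg_cst.
  have b1 (x : R) : `|(cst 1 : R -> R) x| <= 1 by rewrite normr1.
  have h := cvg_damped_integral _ _ _ Q _ _ 1 mN (fun w => normr_ge0 _) c1 b1.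
  have h1 : \int[Q]_w expR (- n.+1%:R^-1 * `|V' w|) @[n --> \oo] --> (1 : R).
    apply/fine_cvg; rewrite [X in _ --> X](_ : _ = (\int[Q]_w (cst 1 `|V' w|)%:E)%E); last first.
      rewrite (eq_integral (cst 1%E)) // integral_cst // mul1e.
      by apply/esym; exact: probability_setT.
    rewrite (_ : (fun n => _) = (fun n =>
      (\int[Q]_w (expR (- n.+1%:R^-1 * `|V' w|) * cst 1 `|V' w|)%:E)%E)) //.
    by apply/funext => n; apply: eq_integral => w _; rewrite mulr1.
  have /cvgrPdist_lt /(_ _ eta0) [m _ /(_ m (leqnn m))] := h1.
  rewrite /= ltr_norml => /andP[_ h2]; exists m.
  by move: h2; move: (\int[Q]_w _) => I; clear; lra.
pose s : R := m.+1%:R^-1; have s0 : 0 <= s by rewrite invr_ge0.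
have EVs : \int[P]_w expR (- s * `|V n w|) @[n --> \oo] --> \int[Q]_w expR (- s * `|V' w|).
  have bs : exists M : R, forall x : R, `|expR (- s * `|x|)| <= M by exists 1 => x; exact: exp1.
  have := cV (fun v => expR (- s * `|v|)) (expc s) bs.
  rewrite (EintE _ _ _ Q _ 1) //; [|exact: measurable_expR_normr|by move=> w; exact: exp1].
  by move=> h; apply/fine_cvg; exact: h.
have e20 : 0 < e / 2 by rewrite divr_gt0.
have [dl dl0 Hd] := curve_uniform_continuity R _ f (fun v => v *: c) 0 m.+1%:R _ cf ch e20.
near=> n.
have hn : 1 - eta < \int[P]_w expR (- s * `|V n w|).
  near: n; have /cvgrPdist_lt := EVs.
  have g0 : 0 < \int[Q]_w expR (- s * `|V' w|) - (1 - eta) by rewrite subr_gt0.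
  move=> /(_ _ g0); apply: filterS => n; rewrite ltr_norml => /andP[_].
  by rewrite ltrBrDl; move: (\int[Q]_w _) (\int[P]_w _) => a b; clear; lra.
have hF w : V n w <= m.+1%:R -> `|V n w *: c - F n w| < dl.
  by move: w; near: n; exact: FV.
(* Up to [m.+1] uniform continuity along the segment gives e/2; beyond it s V > 1, so the
   exponential is below 1/2 and the trivial bound 2B is covered by the second term. *)
have pt w : `|f (F n w) - f (V n w *: c)| <= e / 2 + 4 * B * (1 - expR (- s * `|V n w|)).
  have /andP[q0 q1] := exp01 s (V n w) s0.
  have [h|h] := leP (V n w) m.+1%:R.
    rewrite distrC; apply: (@le_trans _ _ (e / 2)).
      by apply: Hd; [rewrite V0|exact: hF].
    by rewrite lerDl mulr_ge0 ?mulr_ge0 ?subr_ge0.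
  have q2 : expR (- s * `|V n w|) <= 2^-1.
    have m0 : 0 < m.+1%:R :> R by rewrite ltr0n.
    apply: (@le_trans _ _ (expR (- 1))).
      rewrite ler_expR mulNr lerN2 ger0_norm ?V0 // /s mulrC ler_pdivlMr // mul1r.
      exact: ltW.
    rewrite expRN lef_pV2 ?posrE ?expR_gt0 //.
    by apply: le_trans (expR_ge1Dx 1); clear; lra.
  have q3 : `|f (F n w) - f (V n w *: c)| <= 2 * B.
    by rewrite (le_trans (ler_normB _ _)) //; have := fB (F n w); have := fB (V n w *: c); clear; lra.
  have q4 : 4 * B * 2^-1 <= 4 * B * (1 - expR (- s * `|V n w|)).
    by rewrite ler_wpM2l ?mulr_ge0 //; move: q2; clear; lra.
  by move: q3 q4 e20; clear; lra.
have iF := integrable_bounded _ _ _ P _ B (mfF n) (fun w => fB _).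
have iV := integrable_bounded _ _ _ P _ B (mfV n) (fun w => fB _).
have iD : P.-integrable setT (EFin \o (fun w => f (F n w) - f (V n w *: c))).
  exact: (integrableB measurableT iF iV).
have iE := integrable_bounded _ _ _ P _ 1 (measurable_expR_normr _ _ _ _ s (mV n)) (fun w => exp1 _ _ s0).
have iC (r : R) : P.-integrable setT (EFin \o (fun _ => r)).
  exact: finite_measure_integrable_cst.
rewrite sub0r normrN -RintegralB //.
apply: (le_trans (le_normr_Rintegral measurableT iD)).
apply: (@le_trans _ _ (\int[P]_w (e / 2 + 4 * B * (1 - expR (- s * `|V n w|))))).
  apply: le_Rintegral => //; first exact: (integrable_norm iD).
  have h1 := integrableB measurableT (iC 1) iE.
  have h2 := integrableZl measurableT (4 * B) h1.
  exact: (integrableD measurableT (iC (e / 2)) h2).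
have iE1 : P.-integrable setT (EFin \o (fun w => 1 - expR (- s * `|V n w|))).
  exact: (integrableB measurableT (iC 1) iE).
rewrite RintegralD //; last exact: (integrableZl measurableT (4 * B) iE1).
rewrite RintegralZl // RintegralB // !Rintegral_cst // [X in fine X](_ : _ = 1%E); last first.
  exact: probability_setT.
have etaE : (4 * B + 4) * eta = e / 2 by rewrite /eta; field; rewrite gt_eqF //; move: B0; clear; lra.
rewrite /= !mulr1.
have q5 : 4 * B * (1 - \int[P]_w expR (- s * `|V n w|)) <= 4 * B * eta.
  by rewrite ler_wpM2l ?mulr_ge0 //; move: hn; clear; lra.
by move: q5 etaE eta0; clear; lra.
Unshelve. all: by end_near.
Qed.

(** * Entropy and disequilibrium of near-uniform vectors *)

Lemma sum_cube_le (R : realType) (N : nat) (h : 'I_N -> R) (eta : R) : 0 <= eta ->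
  \sum_k h k ^+ 2 <= eta ^+ 2 -> \sum_k `|h k| ^+ 3 <= eta * \sum_k h k ^+ 2.
Proof.
move=> eta0 hS; rewrite mulr_sumr ler_sum // => k _.
rewrite exprS real_normK ?num_real // ler_wpM2r ?sqr_ge0 //.
rewrite -(@ler_pXn2r _ 2) ?nnegrE // real_normK ?num_real //.
by apply: le_trans hS; rewrite (bigD1 k) //= lerDl sumr_ge0 // => j _; exact: sqr_ge0.
Qed.

Lemma nOP_fact (m : nat) : nOP m = m`!.
Proof. by rewrite /nOP -card_Sn. Qed.

(** For the mixture with u the deviation is h/2: the quadratic term is divided by 4 and the cubic
    remainder by 8. The remainders of the two entropies add up to 5/4 of m!^2 sum |h|^3, within the
    factor 2 claimed. *)
Lemma entropy_diseq_expansion (R : realType) (m : nat) (p : 'I_(nOP m) -> R) :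
  (forall k, 0 <= p k) -> \sum_k p k = 1 ->
  let h k := p k - m`!%:R^-1 in
  `|shannonH p - ln m`!%:R + m`!%:R / 2 * \sum_k h k ^+ 2| <=
    2 * m`!%:R ^+ 2 * \sum_k `|h k| ^+ 3 /\
  `|diseq p - m`!%:R / 8 * \sum_k h k ^+ 2| <= 2 * m`!%:R ^+ 2 * \sum_k `|h k| ^+ 3.
Proof.
move=> p0 p1 h.
have N0 : (0 < nOP m)%N by rewrite nOP_fact fact_gt0.
have n0 : 0 < m`!%:R :> R by rewrite ltr0n fact_gt0.
have cE : (nOP m)%:R = m`!%:R :> R by rewrite nOP_fact.
have h1 := entropy_expansion R _ p N0 p0 p1.
have q0 k : 0 <= (p k + m`!%:R^-1) / 2 by rewrite divr_ge0 // addr_ge0 // invr_ge0 ltW.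
have q1 : \sum_k (p k + m`!%:R^-1) / 2 = 1 :> R.
  rewrite -mulr_suml big_split /= p1 sumr_const card_ord -[_ *+ _]mulr_natl cE divff ?gt_eqF //.
  by field.
have h2 := entropy_expansion R _ _ N0 q0 q1.
rewrite !cE in h1 h2.
have e1 : \sum_k ((p k + m`!%:R^-1) / 2 - m`!%:R^-1) ^+ 2 = (\sum_k h k ^+ 2) / 4.
  by rewrite mulr_suml; apply: eq_bigr => k _; rewrite /h; field; rewrite gt_eqF.
have e2 : \sum_k `|(p k + m`!%:R^-1) / 2 - m`!%:R^-1| ^+ 3 = (\sum_k `|h k| ^+ 3) / 8.
  rewrite mulr_suml; apply: eq_bigr => k _.
  have -> : (p k + m`!%:R^-1) / 2 - m`!%:R^-1 = h k / 2 by rewrite /h; field; rewrite gt_eqF.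
  by rewrite normrM [`|2^-1|]ger0_norm ?invr_ge0 //; field.
rewrite e1 e2 in h2.
split; first exact: h1.
have S0 : 0 <= m`!%:R ^+ 2 * \sum_k `|h k| ^+ 3.
  by rewrite mulr_ge0 ?sqr_ge0 // sumr_ge0.
have {}h1 : `|shannonH p - ln m`!%:R + m`!%:R / 2 * \sum_k h k ^+ 2| <=
    2 * (m`!%:R ^+ 2 * \sum_k `|h k| ^+ 3) by rewrite mulrA.
have {}h2 : `|shannonH (fun k => (p k + m`!%:R^-1) / 2) - ln m`!%:R +
      m`!%:R / 8 * \sum_k h k ^+ 2| <= (m`!%:R ^+ 2 * \sum_k `|h k| ^+ 3) / 4.
  have -> : m`!%:R / 8 * \sum_k h k ^+ 2 = m`!%:R / 2 * ((\sum_k h k ^+ 2) / 4) :> R by field.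
  by apply: le_trans h2 _; rewrite le_eqVlt; apply/orP; left; apply/eqP; field.
have -> : diseq p - m`!%:R / 8 * \sum_k h k ^+ 2 =
    (shannonH (fun k => (p k + m`!%:R^-1) / 2) - ln m`!%:R + m`!%:R / 8 * \sum_k h k ^+ 2) -
    (shannonH p - ln m`!%:R + m`!%:R / 2 * \sum_k h k ^+ 2) / 2.
  by rewrite /diseq; field.
rewrite -[2 * _ * _]mulrA; move: h1 h2 S0.
move: (_ - ln _ + m`!%:R / 2 * _) (_ - ln _ + m`!%:R / 8 * _) (m`!%:R ^+ 2 * _).
clear => a b c; rewrite !ler_norml => /andP[a1 a2] /andP[b1 b2] c0.
by apply/andP; split; lra.
Qed.

(** * Measurability of functionals of ordinal patterns, and relative frequencies *)

(** Every preimage is a finite union of cells cut out by the Boolean observables, so no regularity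
    of [f] enters. *)
Lemma measurable_finite_code d (T : measurableType d) d' (T' : measurableType d')
    (I : finType) (b : I -> T -> bool) (f : T -> T') :
  (forall i, measurable_fun setT (b i)) ->
  (forall w v, (forall i, b i w = b i v) -> f w = f v) -> measurable_fun setT f.
Proof.
move=> mb fb _ A mA; rewrite setTI.
rewrite [X in measurable X](_ : _ = \bigcup_(x in [set x : {ffun I -> bool} |
    exists w, (forall i, b i w = x i) /\ A (f w)])
    \bigcap_(i in [set: I]) (b i @^-1` [set x i])).
  apply: fin_bigcup_measurable; first exact: finite_finset.
  move=> x _; apply: fin_bigcap_measurable; first exact: finite_finset.
  by move=> i _; rewrite -[X in measurable X]setTI; exact: mb.
apply/seteqP; split => w /=.
  move=> Aw; exists [ffun i => b i w] => /=.
    by exists w; split => // i; rewrite ffunE.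
  by move=> i _ /=; rewrite ffunE.
move=> [x [v [bv Av]] bw]; rewrite (fb w v) // => i.
by rewrite bv; exact: bw.
Qed.

Lemma eq_ordpat (R : realType) (m : nat) (x y : 'I_m -> R) :
  (forall i j, (x i < x j) = (y i < y j)) -> ordpat x = ordpat y.
Proof.
move=> xy; rewrite /ordpat; congr odflt; apply: eq_pick => s.
apply: eq_forallb => i; apply: eq_forallb => j.
by rewrite !(eq_le _ (_ (s j))) !leNgt !xy.
Qed.

(** Patterns up to time [n] depend only on the finitely many comparisons between the values at times
    0 to n + m. *)
Lemma measurable_OPseries_path d (T : measurableType d) d' (T' : measurableType d')
    (R : realType) (m n : nat) (X : nat -> T -> R) (f : T -> T') :
  (forall t, measurable_fun setT (X t)) ->
  (forall w v, (forall t, (t <= n)%N -> OPseries m X t w = OPseries m X t v) -> f w = f v) ->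
  measurable_fun setT f.
Proof.
move=> mX fE.
apply: (measurable_finite_code _ _ _ _ _
  (fun (q : 'I_(n + m).+1 * 'I_(n + m).+1) w => X q.1 w < X q.2 w)).
  by move=> q; exact: measurable_fun_ltr.
move=> w v wv; apply: fE => t tn; apply: eq_ordpat => i j.
have lt k : (k < m)%N -> (t + k < (n + m).+1)%N.
  by move=> km; rewrite ltnS leq_add // ltnW.
exact: (wv (Ordinal (lt i (ltn_ord i)), Ordinal (lt j (ltn_ord j)))).
Qed.

Lemma phat_ge0 (R : realType) d (T : measurableType d) (m : nat)
  (Pi : nat -> T -> {perm 'I_m}) n w i : 0 <= phat Pi n w i :> R.
Proof. by rewrite /phat mulr_ge0 ?invr_ge0 // sumr_ge0. Qed.

Lemma sum_phat (R : realType) d (T : measurableType d) (m : nat)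
  (Pi : nat -> T -> {perm 'I_m}) n w : (0 < n)%N -> \sum_i phat Pi n w i = 1 :> R.
Proof.
move=> n0; rewrite /phat -mulr_sumr exchange_big /=.
rewrite (eq_bigr (fun=> 1)) => [|t _].
  by rewrite sumr_const_nat subn1 mulVf // pnatr_eq0 -lt0n.
rewrite (bigD1 (enum_rank (Pi t w))) //= /piOP enum_rankK eqxx big1 ?addr0 // => i ni.
by case: eqP => // e; rewrite e enum_valK eqxx in ni.
Qed.

Lemma eq_phat (R : realType) d (T : measurableType d) (m : nat)
  (Pi : nat -> T -> {perm 'I_m}) n w v : (forall t, (t <= n)%N -> Pi t w = Pi t v) ->
  phat Pi n w = phat Pi n v :> (_ -> R).
Proof.
move=> wv; apply/funext => i; rewrite /phat; congr (_ * _).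
by apply: eq_big_nat => t /andP[_ tn]; rewrite wv.
Qed.

(** Where V <= M the deviation satisfies |h|^2 <= |M|/n, so |h| <= eta for large n and n times the
    cubic remainder is at most eta K V, uniformly in [p]. *)
Lemma entropy_diseq_cvg (R : realType) (m : nat) (M dlt : R) : 0 < dlt ->
  \forall n \near \oo, forall p : 'I_(nOP m) -> R,
    (forall k, 0 <= p k) -> \sum_k p k = 1 ->
    let V := \sum_k (Num.sqrt n%:R * (p k - m`!%:R^-1)) ^+ 2 in
    V <= M ->
    `|V *: (\row_(j < 2) (if j == 0 then - (m`!%:R / 2) else m`!%:R / 8)) -
      \row_(j < 2) (if j == 0 then n%:R * (shannonH p - ln m`!%:R) else n%:R * diseq p)| < dlt.
Proof.
move=> dlt0; pose K : R := 2 * m`!%:R ^+ 2.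
have K0 : 0 <= K by rewrite mulr_ge0 ?sqr_ge0.
have KM0 : 0 < K * `|M| + 1 by rewrite ltr_wpDl // mulr_ge0.
(* This makes eta K |M| < dlt; the summand 1 keeps the quotient defined when M = 0. *)
pose eta := dlt / (K * `|M| + 1).
have eta0 : 0 < eta by rewrite divr_gt0.
near=> n; move=> p p0 p1.
pose V := \sum_k (Num.sqrt n%:R * (p k - m`!%:R^-1)) ^+ 2; rewrite /= -/V => VM.
have n0 : 0 < n%:R :> R by rewrite ltr0n; near: n; exact: nbhs_infty_gt.
pose h k := p k - m`!%:R^-1; pose S := \sum_k h k ^+ 2.
have VE : V = n%:R * S.
  by rewrite /V /S mulr_sumr; apply: eq_bigr => k _; rewrite exprMn sqr_sqrtr // ltW.
have V0 : 0 <= V by rewrite /V sumr_ge0 // => k _; exact: sqr_ge0.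
have Mn : `|M| / eta ^+ 2 <= n%:R by near: n; exact: nbhs_infty_ger.
have SM : S <= eta ^+ 2.
  rewrite -(ler_pM2l n0) -VE (le_trans VM) // (le_trans (ler_norm M)) //.
  by rewrite -ler_pdivrMr // exprn_gt0.
have T3 := sum_cube_le _ _ h _ (ltW eta0) SM.
have bnd : n%:R * (K * \sum_k `|h k| ^+ 3) < dlt.
  apply: (@le_lt_trans _ _ (eta * (K * `|M|))).
    apply: (@le_trans _ _ (n%:R * (K * (eta * S)))).
      by rewrite ler_wpM2l ?(ltW n0) // ler_wpM2l.
    rewrite [leLHS](_ : _ = eta * (K * V)); last by rewrite VE; ring.
    by rewrite ler_wpM2l ?(ltW eta0) // ler_wpM2l // (le_trans VM) // ler_norm.
  by rewrite /eta mulrAC ltr_pdivrMr // ltr_pM2l // ltrDl.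
have [hH hD] := entropy_diseq_expansion _ _ p p0 p1.
(* The norm is the largest absolute entry: it is 0 or attained at some entry, which is then one of
   the two remainders. *)
set A := _ - _; rewrite [`|A|]/Num.norm /=.
have [->//|/mx_norm_neq0 [[i j] ->]] := eqVneq (mx_norm A) 0.
apply: le_lt_trans bnd; rewrite /= !mxE VE.
case: eqP => _.
  rewrite [X in `|X|](_ : _ = - (n%:R *
    (shannonH p - ln m`!%:R + m`!%:R / 2 * S))); last by ring.
  by rewrite normrN normrM gtr0_norm // ler_wpM2l // ltW.
rewrite [X in `|X|](_ : _ = - (n%:R * (diseq p - m`!%:R / 8 * S))); last by ring.
by rewrite normrN normrM gtr0_norm // ler_wpM2l // ltW.
Unshelve. all: by end_near. Qed.

(** * The eigenvalues of Sigma and the limit theorem *)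

Lemma trmx_SigmaOP (R : realType) d (T : measurableType d) (P : probability T R)
  (m : nat) (Pi : nat -> T -> {perm 'I_m}) : (SigmaOP P Pi)^T = SigmaOP P Pi.
Proof.
apply/matrixP => i j; rewrite !mxE; congr (_ + limn _).
  have [->//|ij] := eqVneq i j; rewrite !sub0r !mulrN mulrC //.
apply/funext => n; apply: eq_bigr => k _; rewrite /sigma_term.
by rewrite [pOP2 _ _ j i _ + _]addrC mulrAC.
Qed.

(** Each [lam i] occurs among the nonnegative [mu 0 j]. Positive weights keep the limit nonnegative,
    and positive multiplicities make the chi-square density integrable at 0. *)
Lemma psd_nonzero_eigen_spec (R : realType) (N : nat) (S : 'M[R]_N) (mu : 'rV[R]_N)
    (l : nat) (lam : 'I_l -> R) (r : 'I_l -> nat) :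
  char_poly S = \prod_i ('X - (mu 0 i)%:P) -> (forall i, 0 <= mu 0 i) ->
  nonzero_eigen_spec S lam r -> (forall i, 0 < lam i) /\ (forall i, (0 < r i)%N).
Proof.
move=> cS mu0 [_ [lam0 [eig rE]]].
have rt i : root (char_poly S) (lam i).
  by rewrite -eigenvalue_root_char; apply/eig; [exact: lam0|exists i].
split=> i.
  move: (rt i); rewrite cS /root horner_prod prodf_seq_eq0 => /hasP[j _] /=.
  rewrite hornerXsubC subr_eq0 => /eqP e.
  by rewrite lt_neqAle eq_sym lam0 e mu0.
by rewrite rE -XsubC_dvd ?dvdp_XsubCl ?rt // monic_neq0 ?char_poly_monic.
Qed.

Lemma continuous_sqnorm (R : realType) (N : nat) :
  continuous (fun z : 'rV[R]_N => \sum_i z 0 i ^+ 2).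
Proof.
have h (s : seq 'I_N) : continuous (fun z : 'rV[R]_N => \sum_(i <- s) z 0 i * z 0 i).
  elim: s => [|i s IH].
    under eq_fun do rewrite big_nil; exact: cst_continuous.
  under eq_fun do rewrite big_cons.
  move=> z; have cz := @coord_continuous R 1 N 0 i z.
  exact: (cvgD (cvgM cz cz) (IH z)).
under eq_fun do under eq_bigr do rewrite expr2.
exact: h.
Qed.

Theorem theorem4p6 (R : realType) (d : measure_display) (T : measurableType d)
  (P : probability T R) (m : nat) (X : nat -> T -> R) :
  (2 <= m)%N ->
  (forall t, measurable_fun setT (X t)) ->
  (* (Pi_t) is the stationary series of ordinal patterns of length m of X *)
  stationary P (OPseries m X) ->
  (* the series defining Sigma converge absolutely *)
  (forall i j : 'I_(nOP m),
     cvgn (fun n => \sum_(1 <= k < n) `|sigma_term P (OPseries m X) i j k|)) ->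
  (* assumption (A): sqrt n (phat - p) -->d N(0, Sigma) *)
  (exists (d' : measure_display) (T' : measurableType d') (Q : probability T' R)
          (Z : T' -> 'rV[R]_(nOP m)),
     (forall i, measurable_fun setT (fun w => Z w 0 i)) /\
     is_gaussian Q Z (SigmaOP P (OPseries m X)) /\
     cvg_distr P
       (fun n w => \row_i (Num.sqrt n%:R
                      * (phat (OPseries m X) n w i - pOP P (OPseries m X) i)))
       Q Z) ->
  (* p = u *)
  (forall i : 'I_(nOP m), pOP P (OPseries m X) i = (m`!%:R)^-1) ->
  (* conclusion: for the distinct nonzero eigenvalues lam_i of Sigma with
     algebraic multiplicities r_i, and Q_m = sum_i lam_i chi^2_{r_i}
     (independent), n (H(phat) - log m!, D(phat)) -->d (-m!/2, m!/8) Q_m *)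
  forall (l : nat) (lam : 'I_l -> R) (r : 'I_l -> nat),
    nonzero_eigen_spec (SigmaOP P (OPseries m X)) lam r ->
    exists (d' : measure_display) (T' : measurableType d') (Q : probability T' R)
           (C : 'I_l -> T' -> R),
      (forall i, measurable_fun setT (C i)) /\
      independent_rvs Q C /\
      (forall i, is_chi2 (r i) Q (C i)) /\
      cvg_distr P
        (fun n w => \row_(j < 2)
           (if j == 0 then n%:R * (shannonH (phat (OPseries m X) n w) - ln (m`!%:R))
            else n%:R * diseq (phat (OPseries m X) n w)))
        Q
        (fun w => \row_(j < 2)
           ((if j == 0 then - (m`!%:R / 2) else m`!%:R / 8)
              * \sum_(i < l) lam i * C i w)).
Proof.
move=> _ mX _ _ [d' [T' [Q [Z [mZ [gZ cZ]]]]]] pu l lam r spec.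
case: (real_spectral _ _ _ (trmx_SigmaOP R d T P m (OPseries m X))) => O [mu [OO SE]].
have [mu0 _] := gaussian_sqnorm_laplace _ _ _ Q _ Z _ O mu 0 mZ gZ OO SE.
have cS : char_poly (SigmaOP P (OPseries m X)) = \prod_i ('X - (mu 0 i)%:P).
  by rewrite SE char_poly_orthogonal_diag.
have [lam0 r0] := psd_nonzero_eigen_spec _ _ _ _ _ _ _ cS mu0 spec.
have [d2 [T2 [Q2 [C [[mC C0] indC chiC lapC]]]]] := chi2_family_exists R l r r0.
exists d2, T2, Q2, C; split=> //; split=> //; split=> //.
pose V' w := \sum_i lam i * C i w.
pose c : 'rV[R]_2 := \row_j (if j == 0 then - (m`!%:R / 2) else m`!%:R / 8).
rewrite (_ : (fun w : T2 => \row_j _) = (fun w => V' w *: c)); last first.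
  by apply/funext => w; apply/rowP => j; rewrite !mxE mulrC.
have V'0 w : 0 <= V' w by apply: sumr_ge0 => i _; rewrite mulr_ge0 // ltW.
have mV' : measurable_fun setT V'.
  by apply: measurable_sum => i; exact: measurable_funM.
pose V n w : R := \sum_i (Num.sqrt n%:R * (phat (OPseries m X) n w i - m`!%:R^-1)) ^+ 2.
have mZ2 : measurable_fun setT (fun w => \sum_i Z w 0 i ^+ 2).
  by apply: measurable_sum => i; exact: measurable_funX.
(* Both transforms are products of (1 + 2 s x)^(-1/2), over all eigenvalues on one side and over the
   distinct nonzero ones with multiplicity on the other; the factor is 1 at x = 0. *)
have ZV (f : R -> R) (M : R) : continuous f -> (forall x, `|f x| <= M) ->
    (\int[Q]_w (f (\sum_i Z w 0 i ^+ 2)%R)%:E = \int[Q2]_w (f (V' w))%:E)%E.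
  move=> cf fM.
  apply: (laplace_unique _ _ _ _ _ _ _ _ _ mZ2 mV' _ V'0 _ f M cf fM).
    by move=> w; apply: sumr_ge0 => i _; exact: sqr_ge0.
  move=> s s0.
  have [_ ->//] := gaussian_sqnorm_laplace _ _ _ Q _ Z _ O mu s mZ gZ OO SE.
  under [RHS]eq_integral do rewrite mulNr mulr_sumr.
  under [RHS]eq_integral do under eq_bigr do rewrite mulrA.
  rewrite (lapC (fun i => s * lam i)) => [|i]; last by rewrite mulr_ge0 // ltW.
  congr EFin; case: spec => injl [_ [eigl rl]].
  rewrite (prod_eigenvalues _ _ _ mu _ lam r (fun x => (Num.sqrt (1 + 2 * s * x))^-1)
    cS injl eigl rl).
    by apply: eq_bigr => i _; rewrite mulrA.
  by rewrite mulr0 addr0 sqrtr1 invr1.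
apply: (cvg_distr_uniform_approx _ _ _ _ _ _ _ _ _ V) => //.
(* Dependence on finitely many patterns gives measurability at once, whatever logarithms the
   expression contains. *)
- move=> n f _; refine (measurable_OPseries_path _ _ _ _ R m n X _ mX _) => w v wv.
  by rewrite (eq_phat _ _ _ _ _ _ w v wv).
- move=> n; refine (measurable_OPseries_path _ _ _ _ R m n X _ mX _) => w v wv.
  by rewrite /V (eq_phat _ _ _ _ _ _ w v wv).
- by move=> n w; apply: sumr_ge0 => i _; exact: sqr_ge0.
- move=> M dlt dlt0; have := entropy_diseq_cvg R m M dlt dlt0.
  (* At n = 0 all frequencies are 0, by the convention that 0 has inverse 0, and do not sum to 1;
     this index is left out. *)
  have := nbhs_infty_gt 0%N; apply: filterS2 => n n0 h w VM.
  by apply: h; [move=> k; exact: phat_ge0|exact: sum_phat|exact: VM].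
(* Continuous mapping: (A) is tested on [g] composed with the squared norm, and p = u identifies the
   result with [V n]. *)
- move=> g cg [M gM].
  have cgn : continuous (fun z : 'rV[R]_(nOP m) => g (\sum_i z 0 i ^+ 2)).
    by move=> z; apply: continuous_comp; [exact: continuous_sqnorm|exact: cg].
  have bgn : exists M : R, forall z : 'rV[R]_(nOP m), `|g (\sum_i z 0 i ^+ 2)| <= M.
    by exists M => z; exact: gM.
  have := cZ _ cgn bgn; rewrite [X in _ --> X -> _](ZV g M cg gM).
  rewrite [X in X @ _ --> _ -> _](_ : _ = fun n => Eint P (fun w => g (V n w))) //.
  apply/funext => n; apply: eq_integral => w _.
  by congr (g _)%:E; apply: eq_bigr => i _; rewrite mxE pu.
Qed.
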